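(* Let $\Phi_{ex},\Phi_{im}:T\to\Xi$ with $\Phi_{ex}(\emptyset)\equiv1$ and $\Phi_{im}(\emptyset)\equiv 0$. The numerical solution $Y_1$ given by one step of the implicit Taylor method $$Y_1=B(\Phi_{ex},x_0;h)+B(\Phi_{im},Y_1;h)$$ can be written as a B-series $$Y_1=B(\Phi,x_0;h)$$ with $\Phi$ recursively defined by $$\Phi(\emptyset)\equiv1,\qquad \Phi(\tau)=\Phi_{ex}(\tau)+(\Phi\circ\Phi_{im})(\tau).$$ (The objects $T$, $\Xi$, $B$ and the operation $\circ$ are defined in the context.)
   Context: **Coefficients.** $(\Omega,\mathcal A,\mathcal P)$ is a probability space, and $\Xi$ is the set of families $\{\varphi(h)\}_{h\ge 0}$ of measurable maps $\varphi(h):\Omega\to\mathbb{R}$. The functions $g_0,\dots,g_m:\mathbb{R}^d\to\mathbb{R}^d$ are sufficiently differentiable (they are the coefficients of the SDE $dX=g_0(X)\,dt+\sum_{l=1}^m g_l(X)\star dW_l$, $X(t_0)=x_0$, with $\star$ indicating e.g. the Itô or the Stratonovich integral), and $x_0\in\mathbb{R}^d$. **Trees.** The set $T=\{\emptyset\}\cup T_0\cup\dots\cup T_m$ of $(m+1)$-colored rooted trees is defined recursively. The graph $\bullet_l=[\emptyset]_l$ with only one vertex, of color $l$, belongs to $T_l$. If $\tau_1,\dots,\tau_\kappa\in T$, then $[\tau_1,\dots,\tau_\kappa]_l\in T_l$, where $[\tau_1,\dots,\tau_\kappa]_l$ is the tree formed by joining $\tau_1,\dots,\tau_\kappa$ each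 by a single branch to a common root of color $l$. Trees are not ordered, i.e. the order of subtrees is not significant. Empty subtrees in the bracket are dropped, so $[\emptyset,\dots,\emptyset]_l=\bullet_l$. **Elementary differentials.** $F(\emptyset)(x)=x$, $F(\bullet_l)(x)=g_l(x)$, and $F([\tau_1,\dots,\tau_\kappa]_l)(x)=g_l^{(\kappa)}(x)\big(F(\tau_1)(x),\dots,F(\tau_\kappa)(x)\big)$. **B-series.** For $\phi:T\to\Xi$, the B-series is the formal series $B(\phi,x;h)=\sum_{\tau\in T}\alpha(\tau)\cdot\phi(\tau)(h)\cdot F(\tau)(x)$. Here $\alpha(\emptyset)=\alpha(\bullet_l)=1$ and $\alpha([\tau_1,\dots,\tau_\kappa]_l)=\frac{1}{r_1!r_2!\cdots r_q!}\prod_{j=1}^\kappa\alpha(\tau_j)$, where $r_1,\dots,r_q$ count equal trees among $\tau_1,\dots,\tau_\kappa$. It is assumed throughout that all elementary differentials exist and all considered B-series converge (otherwise one has to consider truncated B-series and discuss the remainder term). **Composition.** For $\phi_x,\phi_y:T\to\Xi$ with $\phi_x(\emptyset)\equiv1$, $$(\phi_x\circ\phi_y)(\tau)=\sum_{(\vartheta,\omega)\in ST(\tau)}\gamma(\tau,\vartheta,\omega)\Big(\phi_y(\vartheta)\prod_{\delta\in\omega}\phi_x(\delta)\Big),$$ with $\gamma(\emptyset,\emptyset,\{\emptyset\})=1$ and, for $\tau\ne\emptyset$, $ST$ and $\gamma$ as follows. **Subtrees and remainders.** A tree $\tau$ is decomposed into a subtree $\vartheta$ sharing the root with $\tau$ (the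 empty tree is also allowed) and the remainder multiset $\omega$ of trees left over when $\vartheta$ is removed from $\tau$. This forms a triple $(\tau,\vartheta,\omega)$; for $\vartheta=\emptyset$ it is $(\tau,\emptyset,\{\tau\})$. The same pair $\tau,\vartheta$ may have more than one remainder multiset. $ST(\tau)$ is the set of all possible subtrees of $\tau$ together with the corresponding remainder multiset: - $ST(\emptyset)=\{(\emptyset,\{\emptyset\})\}$; - $ST(\bullet_l)=\{(\emptyset,\{\bullet_l\}),(\bullet_l,\{\emptyset\})\}$; - for $\tau=[\tau_1,\dots,\tau_\kappa]_l$, $ST(\tau)=\{(\vartheta,\omega):\ \vartheta=[\vartheta_1,\dots,\vartheta_\kappa]_l,\ \omega=\{\omega_1,\dots,\omega_\kappa\},\ (\vartheta_i,\omega_i)\in ST(\tau_i),\ i=1,\dots,\kappa\}\cup\{(\emptyset,\{\tau\})\}$, where $\{\omega_1,\dots,\omega_\kappa\}$ means the multiset of all trees contained in $\omega_1,\dots,\omega_\kappa$. **The combinatorial term $\gamma$.** $\gamma(\tau,\emptyset,\{\tau\})=1$. If $\vartheta=\bullet_l$, $\tau=[\tau_1,\dots,\tau_\kappa]_l$ and $\omega=\{\tau_1,\dots,\tau_\kappa\}$, then $\gamma(\tau,\vartheta,\omega)=1$; likewise $\gamma(\bullet_l,\bullet_l,\{\emptyset\})=1$. In the general case let $\vartheta=[\vartheta_1,\dots,\vartheta_{\kappa_\vartheta}]_l$ and $\tau=[\delta_1,\dots,\delta_{\kappa_0},\tau_1,\dots,\tau_{\kappa_\vartheta}]_l$. Here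 $\delta_1,\dots,\delta_{\kappa_0}$ are the trees of the remainder multiset $\omega$ which are directly connected to the root of $\tau$, $(\vartheta_i,\omega_i)\in ST(\tau_i)$ for $i=1,\dots,\kappa_\vartheta$, and $\omega$ consists of $\delta_1,\dots,\delta_{\kappa_0}$ together with the trees in $\omega_1,\dots,\omega_{\kappa_\vartheta}$. Write $\vartheta=[\bar\vartheta_1^{r_1},\dots,\bar\vartheta_q^{r_q}]_l$, meaning that $\vartheta$ is composed of $q$ different trees $\bar\vartheta_i$, each appearing $r_i$ times. For each $i$ let $\tau_{ik}$, $k=1,\dots,p_i$, be the distinct trees, with multiplicity $r_{ik}$, among the $\tau_j$ of which the $\bar\vartheta_i$ are subtrees, so that $\sum_{k=1}^{p_i}r_{ik}=r_i$. Let $\bar\delta_i$, $i=1,\dots,p_0$, be the distinct trees, with multiplicity $s_i$, among $\delta_1,\dots,\delta_{\kappa_0}$, so that $\sum_{k=1}^{p_0}s_k=\kappa_0$. Then $$\tau=[\bar\delta_1^{s_1},\dots,\bar\delta_{p_0}^{s_{p_0}},\tau_{11}^{r_{11}},\dots,\tau_{1p_1}^{r_{1p_1}},\dots,\tau_{q1}^{r_{q1}},\dots,\tau_{qp_q}^{r_{qp_q}}]_l=[\bar\tau_1^{R_1},\dots,\bar\tau_Q^{R_Q}]_l,$$ where the last expression indicates that $\tau$ is composed of $Q$ different trees $\bar\tau_i$, each appearing $R_i$ times, and $$\gamma(\tau,\vartheta,\omega)=\frac{R_1!\cdots R_Q!}{s_1!\cdots s_{p_0}!\;r_{11}!\cdots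 r_{qp_q}!}\prod_{i=1}^{\kappa_\vartheta}\gamma(\tau_i,\vartheta_i,\omega_i).$$ Since $\Phi_{im}(\emptyset)\equiv0$, the term with $\vartheta=\emptyset$ in $(\Phi\circ\Phi_{im})(\tau)$ vanishes, so the definition of $\Phi$ is a recursion.
   Formalization: The term γ is corrected: it sums over all decompositions of τ giving the same (ϑ,ω), and equal trees τ_i with equal ϑ_i but different remainders ω_i count as distinct; with the formula as written the composition coefficients, and so the claim, are wrong for some trees. *)

(* Defs.v *)
From HB Require Import structures.
From mathcomp Require Import all_boot all_order all_algebra.
From mathcomp Require Import finmap multiset.
From mathcomp Require Import all_classical all_reals all_analysis.
From mathcomp Require Import measurable_realfun.
Import Order.TTheory GRing.Theory Num.Theory.
Import numFieldNormedType.Exports.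

Set Implicit Arguments.
Unset Strict Implicit.
Unset Printing Implicit Defensive.

Local Open Scope ring_scope.

(** * Unordered rooted trees with vertices coloured by [0, ..., m] *)

(* Plane trees; unordered trees are those whose lists of subtrees are sorted
   (hereditarily) for an arbitrary but fixed total order. *)
Inductive ptree (m : nat) : Type := PNode of 'I_m.+1 & seq (ptree m).

Section PlaneTrees.
Variable m : nat.

Fixpoint ptree_code (t : ptree m) : GenTree.tree 'I_m.+1 :=
  let: PNode l s := t in
  GenTree.Node 0 (GenTree.Leaf l :: map ptree_code s).

Fixpoint ptree_decode (c : GenTree.tree 'I_m.+1) : option (ptree m) :=
  if c is GenTree.Node _ (GenTree.Leaf l :: cs) then
    Some (PNode l (pmap ptree_decode cs))
  else None.

Lemma ptree_codeK : pcancel ptree_code ptree_decode.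
Proof.
rewrite /pcancel; fix IH 1; case=> l s /=; congr (Some (PNode _ _)).
by elim: s => //= t s IHs; rewrite IH /= IHs.
Qed.

HB.instance Definition _ := Countable.copy (ptree m) (pcan_type ptree_codeK).

Definition ple (s t : ptree m) := (choice.pickle s <= choice.pickle t)%N.

Lemma ple_total : total ple. Proof. by move=> s t; apply: leq_total. Qed.
Lemma ple_trans : transitive ple. Proof. by move=> s t u; apply: leq_trans. Qed.
Lemma ple_anti : antisymmetric ple.
Proof.
move=> s t; rewrite -eqn_leq => /eqP e.
by apply: (pcan_inj choice.pickleK).
Qed.

Fixpoint canonical (t : ptree m) : bool :=
  let: PNode _ s := t in sorted ple s && all canonical s.

Fixpoint porder (t : ptree m) : nat :=
  let: PNode _ s := t in (sumn (map porder s)).+1.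

End PlaneTrees.

Definition tree (m : nat) := {t : ptree m | canonical t}.
HB.instance Definition _ m := Countable.on (tree m).

(* [None] is the empty tree. *)
Definition T (m : nat) := option (tree m).

Section Trees.
Variable m : nat.
Implicit Types (t : tree m) (s : seq (tree m)).

Definition root t : 'I_m.+1 := let: PNode l _ := val t in l.

Definition children t : seq (tree m) :=
  let: PNode _ s := val t in pmap insub s.

Fact node_subproof (l : 'I_m.+1) s :
  canonical (PNode l (sort (@ple m) (map val s))).
Proof.
rewrite /= (sort_sorted (@ple_total m)) /= all_sort all_map.
by apply/allP => t _ /=; exact: valP.
Qed.

Definition node (l : 'I_m.+1) s : tree m := Sub _ (node_subproof l s).

Definition order t : nat := porder (val t).

Lemma root_node l s : root (node l s) = l.
Proof. by []. Qed.

Lemma map_val_children t :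
  map val (children t) = let: PNode _ s := val t in s.
Proof.
rewrite /children; case: t => -[l s] /= /andP[_ cs].
by rewrite pmap_filter; [apply/all_filterP; rewrite (eq_all (@isSome_insub _ _ _))
                        | exact: insubK].
Qed.

Lemma children_node l s : perm_eq (children (node l s)) s.
Proof.
apply: (perm_map_inj val_inj).
by rewrite map_val_children /= perm_sort.
Qed.

Lemma node_children t : node (root t) (children t) = t.
Proof.
apply: val_inj; rewrite /= map_val_children /root.
case: t => -[l s] /= /andP[ss _]; congr PNode.
exact: (sorted_sort (@ple_trans m)).
Qed.

Lemma node_perm l s1 s2 : perm_eq s1 s2 -> node l s1 = node l s2.
Proof.
move=> e; apply: val_inj => /=; congr PNode.
apply/(perm_sortP (@ple_total m) (@ple_trans m) (@ple_anti m)).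
exact: perm_map.
Qed.

Lemma order_children t : order t = (\sum_(u <- children t) order u)%N.+1.
Proof.
rewrite -(big_map val predT (@porder m)) map_val_children /order.
by case: t => -[l s] /= _; rewrite sumnE big_map.
Qed.

Lemma order_child t u : u \in children t -> (order u < order t)%N.
Proof.
move=> ut; rewrite [order t]order_children (perm_big _ (perm_to_rem ut)) big_cons.
by rewrite ltnS leq_addr.
Qed.

(* The function [r] with [r t = f r t], for [f r t] depending on the values of
   [r] at the children of [t] only; see [tree_fixE]. *)
Definition tree_fix (A : Type) (a : A) (f : (tree m -> A) -> tree m -> A)
  (t : tree m) : A := iter (order t) f (fun=> a) t.

Lemma tree_fixE A a (f : (tree m -> A) -> tree m -> A) :
  (forall t r1 r2, {in children t, r1 =1 r2} -> f r1 t = f r2 t) ->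
  forall t, tree_fix a f t = f (tree_fix a f) t.
Proof.
move=> fP; have o0 u : (0 < order u)%N by rewrite order_children.
have iterP : forall n k t, (order t <= n)%N -> (order t <= k)%N ->
    iter n f (fun=> a) t = iter k f (fun=> a) t.
  elim=> [|n IHn] [|k] t; rewrite ?leqn0 -?lt0n ?gtn_eqF //= => tn tk.
  by apply: fP => u /order_child ut; apply: IHn;
    rewrite -ltnS (leq_trans ut).
move=> t; rewrite {1}/tree_fix -(prednK (o0 t)) /=.
apply: fP => u /order_child ut; apply: iterP => //.
by rewrite -ltnS prednK.
Qed.

(* [theta_1, ..., theta_k]_l, in which empty subtrees are dropped. *)
Definition bracket (l : 'I_m.+1) (s : seq (T m)) : T m :=
  Some (node l (pmap id s)).

Definition orderT (tau : T m) : nat := if tau is Some t then order t else 0%N.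

End Trees.

Local Open Scope mset_scope.
Local Open Scope ring_scope.

(** * Subtrees, remainders and the combinatorial term *)

Section Decompositions.
Variable m : nat.
Implicit Types (t : tree m) (tau theta : T m) (omega : {mset T m}).

(* [(theta, omega)]: a subtree together with the remainder multiset. *)
Local Notation cut := (T m * {mset T m})%type.

(* A decomposition of [t = [t_1, ..., t_k]_l] is the multiset of the triples
   [(t_i, theta_i, omega_i)], with [(theta_i, omega_i)] a cut of [t_i]. *)
Local Notation decomposition := {mset (tree m * cut)}.

(* All [[:: x_1; ...; x_k]] with [x_i] in the [i]th list. *)
Definition selections (X : Type) (ss : seq (seq X)) : seq (seq X) :=
  foldr (fun s cs => [seq x :: c | x <- s, c <- cs]) [:: [::]] ss.

Definition decomps (ST : tree m -> {fset cut}) t : {fset decomposition} :=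
  [fset seq_mset (zip (children t) c)
    | c in selections [seq enum_fset (ST u) | u <- children t]]%fset.

Definition trunk (l : 'I_m.+1) (D : decomposition) : T m :=
  bracket l [seq p.2.1 | p <- D].

(* If [t] is a single vertex then [D] is empty and the remainder is
   [{emptyset}]. *)
Definition remainder (D : decomposition) : {mset T m} :=
  if D == mset0 then [mset None]%mset
  else \big[@msetD _/mset0]_(p <- D) p.2.2.

Definition ST_tree : tree m -> {fset cut} :=
  tree_fix fset0 (fun ST t =>
    (None, [mset Some t]%mset) |`
      [fset (trunk (root t) D, remainder D) | D in decomps ST t])%fset.

Lemma ST_treeE t : ST_tree t =
  ((None, [mset Some t]%mset) |`
    [fset (trunk (root t) D, remainder D) | D in decomps ST_tree t])%fset.
Proof.
rewrite /ST_tree tree_fixE // => u r1 r2 e; rewrite /decomps.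
by have -> : [seq enum_fset (r1 v) | v <- children u] =
    [seq enum_fset (r2 v) | v <- children u] by apply/eq_in_map => v /e ->.
Qed.

Definition ST tau : {fset cut} :=
  if tau is Some t then ST_tree t else [fset (None, [mset None]%mset)]%fset.

(* [R_1! ... R_Q! / (s_1! ... s_p0! r_11! ... r_qpq!)]: the [R]s are the
   multiplicities of the distinct children of [t], the [s]s and [r]s those of
   the distinct triples in [D]; a child [delta] lying entirely in the
   remainder is the triple [(delta, emptyset, {delta})].  Triples which differ
   in their third component only are distinct. *)
Definition multinom t (D : decomposition) : nat :=
  ((\prod_(u <- undup (children t)) (count_mem u (children t))`!)
    %/ (\prod_(p <- finsupp D) (D p)`!))%N.

(* Several decompositions of [t] may give the same [(theta, omega)]; they all
   contribute.  For instance, with [. = [emptyset]_l], [a = [e]_l] and [b <> c],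
   the tree [t = [[a, b]_l, [a, c]_l]_l] and its subtree
   [theta = [[.]_l, .]_l] have the remainder [{a, b, c, e}], whether the root
   of [a] is kept in the first or in the second child of [t]. *)
Definition gamma_tree : tree m -> T m -> {mset T m} -> nat :=
  tree_fix (fun _ _ => 0%N) (fun gamma t theta omega =>
    if theta is None then nat_of_bool (omega == [mset Some t]%mset)
    else \sum_(D <- decomps ST_tree t
                 | (trunk (root t) D == theta) && (remainder D == omega))
           (multinom t D * \prod_(p <- (D : decomposition)) gamma p.1 p.2.1 p.2.2))%N.

Lemma decomps_child (r : tree m -> {fset cut}) t (D : decomposition) p :
  D \in decomps r t -> p \in D -> p.1 \in children t.
Proof.
case/imfsetP => c _ ->; rewrite (perm_mem (perm_eq_seq_mset _)) => pc.
elim: (children t) c pc => [|u us IH] [|x c] //=.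
by rewrite !inE => /predU1P[-> /=|/IH ->]; rewrite ?eqxx ?orbT.
Qed.

Lemma gamma_treeE t theta omega : gamma_tree t theta omega =
  (if theta is None then nat_of_bool (omega == [mset Some t]%mset)
   else \sum_(D <- decomps ST_tree t
                | (trunk (root t) D == theta) && (remainder D == omega))
          (multinom t D * \prod_(p <- (D : decomposition))
                            gamma_tree p.1 p.2.1 p.2.2))%N.
Proof.
rewrite {1}/gamma_tree tree_fixE // => u r1 r2 e.
apply/funext => -[v|]; apply/funext => om //.
rewrite big_seq_cond [RHS]big_seq_cond; apply: eq_bigr => D /andP[Du _].
congr (_ * _)%N; rewrite big_seq [RHS]big_seq; apply: eq_bigr => p pD.
by rewrite e // (decomps_child Du).
Qed.

Definition gamma tau theta omega : nat :=
  if tau is Some t then gamma_tree t theta omega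
  else nat_of_bool ((theta == None) && (omega == [mset None]%mset)).

End Decompositions.

Lemma mem_selections (X : eqType) (s c : seq X) :
  {subset c <= s} -> c \in selections (nseq (size c) s).
Proof.
elim: c => [|x c IH] cs //=; apply/allpairsP; exists (x, c) => /=.
split=> //; first exact/cs/mem_head.
by apply: IH => y yc; apply: cs; rewrite inE yc orbT.
Qed.

Lemma finite_orderT (m n : nat) :
  finite_set [set tau : T m | orderT tau = n]%classic.
Proof.
have [s sP] : exists s : seq (tree m), forall t, (order t <= n)%N -> t \in s.
  elim: n => [|n [s sP]]; first by exists [::] => t; rewrite order_children.
  exists [seq node l c | l <- enum 'I_m.+1,
            c <- flatten [seq selections (nseq k s) | k <- iota 0 n.+1]].
  move=> t; rewrite order_children ltnS => tn.
  have le1 u : u \in children t -> (order u <= n)%N.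
    move=> ut; apply: leq_trans tn; rewrite (perm_big _ (perm_to_rem ut)).
    by rewrite big_cons leq_addr.
  apply/allpairsP; exists (root t, children t).
  rewrite mem_enum node_children; split=> //; apply/flattenP.
  exists (selections (nseq (size (children t)) s)); last first.
    by apply: mem_selections => u /le1 /sP.
  apply/mapP; exists (size (children t)) => //.
  rewrite mem_iota leq0n add0n ltnS; apply: leq_trans tn.
  by rewrite -sum1_size; apply: leq_sum => v _; rewrite (order_children v).
apply: (@sub_finite_set _ _ [set` None :: map Some s]%classic).
  by move=> [t|] //= tn; rewrite inE /= map_f // sP // tn.
exact: finite_seq.
Qed.

(** * Coefficients, composition and B-series *)

Section Coefficients.
Context {disp : measure_display} {Omega : measurableType disp} {R : realType}.
Variable P : probability Omega R.
Variable m : nat.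
Implicit Types (tau : T m).

Definition Xi := {nonneg R} -> {RV P >-> R}.

Definition alpha_tree : tree m -> R :=
  tree_fix 0 (fun alpha t =>
    (\prod_(u <- undup (children t)) ((count_mem u (children t))`!)%:R)^-1
    * \prod_(u <- children t) alpha u).

Lemma alpha_treeE t : alpha_tree t =
  (\prod_(u <- undup (children t)) ((count_mem u (children t))`!)%:R)^-1
  * \prod_(u <- children t) alpha_tree u.
Proof.
rewrite /alpha_tree tree_fixE // => v r1 r2 e; congr (_ * _).
by rewrite big_seq [RHS]big_seq; apply: eq_bigr.
Qed.

Definition alpha tau : R := if tau is Some t then alpha_tree t else 1.

(* [comp phix phiy] is the composition of [phix] and [phiy], in this order. *)
Definition comp (phix phiy : T m -> Xi) tau : Xi := fun h =>
  \sum_(p <- ST tau)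
    (phiy p.1 h * \prod_(delta <- (p.2 : {mset T m})) phix delta h) *+ gamma tau p.1 p.2.

Definition implicit_taylor_coef (Phiex Phiim Phi : T m -> Xi) : Prop :=
  (forall h, Phi None h = 1) /\
  (forall tau h, Phi tau h = Phiex tau h + comp Phi Phiim tau h).

End Coefficients.

Section Series.
Context {disp : measure_display} {Omega : measurableType disp} {R : realType}.
Context {P : probability Omega R} {m d : nat}.
Local Notation V := 'rV[R]_d.
Variable g : 'I_m.+1 -> V -> V.
Implicit Types (phi : T m -> Xi P) (h : {nonneg R}) (w : Omega).
Implicit Types (t : tree m) (tau : T m) (x y v : V) (Y : nat -> V).

(* [iterD f [:: v_1; ...; v_k] x] is [f^(k)(x)(v_1, ..., v_k)]. *)
Definition iterD (f : V -> V) (vs : seq V) : V -> V :=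
  foldr (fun v f => 'D_v f) f vs.

(* Differentiability of all iterated directional derivatives amounts to
   infinite differentiability. *)
Definition smooth (f : V -> V) : Prop :=
  forall vs x, differentiable (iterD f vs) x.

Definition elem_diff_tree : tree m -> V -> V :=
  tree_fix (@id V) (fun F t x =>
    iterD (g (root t)) [seq F u x | u <- children t] x).

Lemma elem_diff_treeE t x :
  elem_diff_tree t x =
  iterD (g (root t)) [seq elem_diff_tree u x | u <- children t] x.
Proof.
rewrite {1}/elem_diff_tree tree_fixE // => u r1 r2 e; apply/funext => z.
by congr iterD; apply/eq_in_map => v /e ->.
Qed.

Definition elem_diff tau : V -> V :=
  if tau is Some t then elem_diff_tree t else id.

(* The sum of the terms of [B(phi, x; h)] over the (finitely many) trees with
   [n] vertices. *)
Definition Bterm phi h w x (n : nat) : V :=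
  \sum_(tau \in [set tau : T m | orderT tau = n]%classic)
    (alpha tau * phi tau h w) *: elem_diff tau x.

(** B-series as formal series.

   The formal series are graded by the number of vertices: [g_l] is replaced by
   [e g_l] for an indeterminate [e], so that [F(tau)] becomes
   [e ^ orderT tau F(tau)].  A formal series [sum_n e^n Y_n] is represented by
   the sequence [Y] of its coefficients; that of [B(phi, x; h)], for a point
   [x], is [Bterm phi h w x].  In order to replace the point by a formal series
   [Y], [g_l] and its derivatives are evaluated at [Y] by Taylor's formula at
   [Y 0]. *)

(* Coefficients of [M(V_1, ..., V_k)], for [M] multilinear. *)
Fixpoint multilin_fs (M : seq V -> V) (Vs : seq (nat -> V)) (n : nat) : V :=
  if Vs is W :: Vs' then
    \sum_(i < n.+1) multilin_fs (fun vs => M (W i :: vs)) Vs' (n - i)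
  else if n == 0%N then M [::] else 0.

(* Coefficients of
   [f^(k)(Y)(V_1, ..., V_k)
      = sum_j 1/j! f^(k+j)(Y_0)(Y - Y_0, ..., Y - Y_0, V_1, ..., V_k)];
   the terms with [j > n] do not contribute to the [n]th one. *)
Definition taylor_fs (f : V -> V) Y (Vs : seq (nat -> V)) (n : nat) : V :=
  let dY i := if i == 0%N then 0 else Y i in
  \sum_(j < n.+1) (j`!%:R)^-1 *:
    multilin_fs (fun vs => iterD f vs (Y 0%N)) (nseq j dY ++ Vs) n.

(* [F(tau)(Y)], without the factor [e ^ orderT tau]. *)
Definition elem_diff_tree_fs Y : tree m -> nat -> V :=
  tree_fix (fun=> 0) (fun F t =>
    taylor_fs (g (root t)) Y [seq F u | u <- children t]).

Lemma elem_diff_tree_fsE Y t :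
  elem_diff_tree_fs Y t =
  taylor_fs (g (root t)) Y [seq elem_diff_tree_fs Y u | u <- children t].
Proof.
rewrite {1}/elem_diff_tree_fs tree_fixE // => u r1 r2 e.
by congr taylor_fs; apply/eq_in_map => v /e ->.
Qed.

Definition elem_diff_fs Y tau : nat -> V :=
  if tau is Some t then elem_diff_tree_fs Y t else Y.

(* The part of [B(phi, Y; h)] given by the trees with [k] vertices, without the
   factor [e ^ k]. *)
Definition Bhom_fs phi h w Y (k j : nat) : V :=
  \sum_(tau \in [set tau : T m | orderT tau = k]%classic)
    (alpha tau * phi tau h w) *: elem_diff_fs Y tau j.

Definition Bseries_fs phi h w Y (n : nat) : V :=
  \sum_(k < n.+1) Bhom_fs phi h w Y k (n - k).

(* [Y = B(Phiex, x0; h) + B(Phiim, Y; h)] as formal series. *)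
Definition formal_step (Phiex Phiim : T m -> Xi P) h w x0 Y : Prop :=
  forall n, Y n = Bterm Phiex h w x0 n + Bseries_fs Phiim h w Y n.

(** B-series as convergent series, summed by increasing number of vertices *)

(* The expansions of [y] and of the elementary differentials at [y] converge,
   absolutely so in [B(phi, y; h)], where they are rearranged. *)
Definition expansions_converge phi h w Y y : Prop :=
  [/\ series Y @ \oo --> y,
      forall tau, series (elem_diff_fs Y tau) @ \oo --> elem_diff tau y &
      exists C : R, forall K J : nat,
        \sum_(k < K) \sum_(j < J) `|Bhom_fs phi h w Y k j| <= C]%classic.

(* [y = B(Phiex, x0; h) + B(Phiim, y; h)], both series being convergent. *)
Definition step (Phiex Phiim : T m -> Xi P) h w x0 y : Prop :=
  exists bex bim : V,
    [/\ series (Bterm Phiex h w x0) @ \oo --> bex,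
        series (Bterm Phiim h w y) @ \oo --> bim &
        y = bex + bim]%classic.

End Series.

(* Main.v *)
(** The core is the composition rule: if the formal series [Y] is the B-series
   [B(Phi, x0; h)] with [Phi(emptyset) = 1], then [B(Phiim, Y; h)] is the
   B-series of [Phi o Phiim].  It follows from an expansion of every elementary
   differential,
     [alpha(theta) F(theta)(Y)
        = sum_(u, omega) alpha(u) gamma(u, theta, omega)
            prod_(delta in omega) Phi(delta) F(u)(x0)],
   where [(theta, omega)] ranges over the cuts of [u] with subtree [theta].
   It is proved by induction on [theta]: in Taylor's formula for
   [g_l^(k)(Y)(F(theta_1)(Y), ..., F(theta_k)(Y))] the arguments [Y - x0] and
   [F(theta_i)(Y)] are sums over cuts with subtree [emptyset] and [theta_i], and
   by symmetry of the derivatives the product depends only on the multiset of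
   the cuts chosen; counting the orderings of this multiset gives [gamma].
   As [Phiim(emptyset) = 0], the coefficient of order [n] of [B(Phiim, Y; h)]
   depends on the coefficients of [Y] of order [< n] only, hence the formal
   equation has just one solution.  For convergent series, the absolutely
   convergent double series [B(Phiim, Y; h)] is rearranged along its
   diagonals. *)

From mathcomp Require Import all_boot all_order all_algebra.
From mathcomp Require Import finmap multiset.
From mathcomp Require Import all_classical all_reals all_analysis.
From mathcomp Require Import measurable_realfun.
From mathcomp Require Import zify ring lra.
Require Import Defs.
Import Order.TTheory GRing.Theory Num.Theory.
Import numFieldNormedType.Exports.

Set Implicit Arguments.
Unset Strict Implicit.
Unset Printing Implicit Defensive.

Local Open Scope mset_scope.
Local Open Scope classical_set_scope.
Local Open Scope ring_scope.

(** * Multiplicities and the counting of orderings *)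

(** The number of permutations of the positions that fix the list [s]; the symmetry factor in
    [alpha] and the factorials in [gamma] have this form. *)
Definition multfact (X : eqType) (s : seq X) : nat :=
  (\prod_(u <- undup s) (count_mem u s)`!)%N.

Section Multiplicities.
Implicit Types X Y : eqType.
Local Open Scope nat_scope.

Lemma multfact_gt0 X (s : seq X) : 0 < multfact s.
Proof. by rewrite prodn_gt0 // => i; apply: fact_gt0. Qed.

Lemma perm_multfact X (s1 s2 : seq X) :
  perm_eq s1 s2 -> multfact s1 = multfact s2.
Proof.
move=> e; rewrite /multfact (perm_big _ (perm_undup (perm_mem e))).
by apply: eq_bigr => u _; rewrite (permP e).
Qed.

Lemma multfact_cons X (x : X) s :
  multfact (x :: s) = (count_mem x s).+1 * multfact s.
Proof.
rewrite /multfact /=; case: ifPn => xs.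
  rewrite !(bigD1_seq x) ?mem_undup ?undup_uniq //= eqxx add1n factS.
  rewrite -mulnA; congr (_ * (_ * _)).
  by apply: eq_bigr => u; rewrite eq_sym => /negbTE ->.
rewrite big_cons eqxx add1n (count_memPn xs) !mul1n.
rewrite big_seq [RHS]big_seq; apply: eq_bigr => u; rewrite mem_undup.
by rewrite eq_sym; case: eqP => // -> us; rewrite us in xs.
Qed.

Lemma multfact_nseq_cat X (x : X) j s : x \notin s ->
  multfact (nseq j x ++ s) = j`! * multfact s.
Proof.
move=> xs; elim: j => [|j IH]; first by rewrite mul1n.
rewrite /= multfact_cons IH count_cat count_nseq /= eqxx mul1n.
by rewrite (count_memPn xs) addn0 factS mulnA.
Qed.

Lemma multfact_map X Y (f : X -> Y) s : injective f ->
  multfact (map f s) = multfact s.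
Proof.
move=> fI; elim: s => [|x s IH] /=; rewrite /= ?multfact_cons ?IH //.
  by rewrite /multfact !big_nil.
by congr (_.+1 * _); rewrite count_map; apply: eq_count => y; rewrite /= inj_eq.
Qed.

Lemma sum_count_undup X (P : pred X) s :
  \sum_(x <- undup s | P x) count_mem x s = count P s.
Proof.
rewrite -[RHS]sum1_count -[RHS]big_undup_iterop_count; apply: eq_bigr => x _.
by rewrite Monoid.iteropE; elim: (count_mem x s) => //= n <-.
Qed.

(** Orbit counting: an ordering of [D] that lifts [x :: k] starts with some [p] over [x] and goes on
    with an ordering of [rem p D] that lifts [k]; the multiplicities in [D] of the elements over [x]
    add up to that of [x]. The quotient of the two [multfact] is the multinomial factor of
    [gamma]. *)
Lemma count_permutations_map X Y (phi : X -> Y) D k :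
  perm_eq (map phi D) k ->
  count (fun L => map phi L == k) (permutations D) * multfact D = multfact k.
Proof.
elim: k D => [|x k IH] D e.
  have -> : D = [::] by apply/nilP; rewrite /nilp -(size_map phi) (perm_size e).
  by rewrite /multfact !big_nil.
have D0 : 0 < size D by rewrite -(size_map phi) (perm_size e).
rewrite (permP (permutationsE D0)) count_flatten -map_comp sumnE big_map big_distrl /=.
rewrite multfact_cons -[X in X * _]/(1 + _).
have -> : 1 + count_mem x k = \sum_(p <- undup D | phi p == x) count_mem p D.
  rewrite sum_count_undup -[RHS](count_map phi (pred1 x)) (permP e) /= eqxx //.
rewrite big_distrl /= [RHS]big_mkcond big_seq [RHS]big_seq.
apply: eq_bigr => p; rewrite mem_undup => pD /=; rewrite count_map.
have [px|px] := eqVneq (phi p) x; last first.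
  rewrite (eq_count (a2 := pred0)) ?count_pred0 // => L /=.
  by rewrite eqseq_cons (negbTE px).
have e' : perm_eq (map phi (rem p D)) k.
  rewrite -(perm_cons x) -(permPr e) -px -map_cons.
  by apply: perm_map; rewrite perm_sym perm_to_rem.
rewrite -(IH _ e') (perm_multfact (perm_to_rem pD)) multfact_cons.
rewrite mulnCA; congr (_ * _).
  by rewrite (permP (perm_to_rem pD)) /= eqxx.
by congr (_ * _); apply: eq_count => L /=; rewrite eqseq_cons px eqxx.
Qed.

End Multiplicities.

(** * From lists to multisets: selections and decompositions *)

(** The lists are grouped by their multiset. On each group [f] is constant, and the hypotheses on
    [LL] and [E] make the group of [D] the set of all orderings of [D] that [phi] maps to [k]. *)
Lemma sum_over_msets (X : choiceType) (Y : eqType) (phi : X -> Y) (k : seq Y)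
    (V : nmodType) (f : seq X -> V) (LL : seq (seq X)) (E : seq {mset X}) :
  uniq LL -> uniq E ->
  {in LL, forall L, (map phi L = k) /\ seq_mset L \in E} ->
  {in E, forall (D : {mset X}) L, perm_eq L D -> map phi L = k -> L \in LL} ->
  (forall L1 L2, perm_eq L1 L2 -> f L1 = f L2) ->
  \sum_(L <- LL) f L =
  \sum_(D <- E) f D *+ count (fun L => map phi L == k) (permutations D).
Proof.
move=> LLu Eu LLE ELL fP.
transitivity (\sum_(L <- LL) \sum_(D <- E | D == seq_mset L) f D).
  rewrite big_seq [RHS]big_seq; apply: eq_bigr => L /LLE[_ LE].
  rewrite -big_filter filter_pred1_uniq // big_seq1; apply: fP.
  by rewrite perm_sym; apply: perm_eq_seq_mset.
rewrite (exchange_big_dep predT) //= big_seq [RHS]big_seq.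
apply: eq_bigr => D DE; rewrite big_const_seq iter_addr_0; congr (_ *+ _).
rewrite -!size_filter; apply: perm_size; apply: uniq_perm.
- exact: filter_uniq.
- by apply: filter_uniq; apply: permutations_uniq.
move=> L; rewrite !mem_filter mem_permutations.
have eD (A : {mset X}) : (A == seq_mset L) = perm_eq L A.
  apply/eqP/idP => [->|e]; first by rewrite perm_sym; apply: perm_eq_seq_mset.
  by rewrite -[LHS]seq_mset_id; apply/eq_seq_msetP; rewrite perm_sym.
rewrite eD; apply/andP/andP => -[].
  by move=> e /LLE[-> _].
by move=> /eqP Lk e; split => //; apply: ELL e Lk.
Qed.

Section Selections.
Variable X : eqType.
Implicit Types (c : seq X) (ss : seq (seq X)).

Lemma selectionsP ss c :
  (c \in selections ss) = all2 (fun x s => x \in s) c ss.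
Proof.
elim: ss c => [|s ss IH] [|x c] //=.
  by apply/negP => /allpairsP[p [_ _]].
rewrite -IH; apply/allpairsP/andP => [[[y d] [/= ys dss [-> ->]]]|[xs css]] //.
by exists (x, c).
Qed.

Lemma selections_uniq ss : all uniq ss -> uniq (selections ss).
Proof.
elim: ss => [|s ss IH] //= /andP[us uss].
by apply: allpairs_uniq => //; [exact: IH | move=> [a b] [a' b'] _ _ /= [-> ->]].
Qed.

End Selections.

Lemma mem_fibre_selections (X Y : eqType) (phi : X -> Y) (S : seq X) k c :
  (c \in selections [seq [seq p <- S | phi p == x] | x <- k]) =
  all (mem S) c && (map phi c == k).
Proof.
rewrite selectionsP; elim: k c => [|x k IH] [|p c] //=.
  by rewrite andbF.
by rewrite IH mem_filter eqseq_cons; case: (_ \in _); case: (_ == _);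
  rewrite ?andbF ?andbT.
Qed.

Section MemDecomps.
Variable m : nat.
Local Notation cut := (T m * {mset T m})%type.
Implicit Types (t : tree m) (r : tree m -> {fset cut}).

(** Frees decompositions from the fixed order of [children t]: if the first components are the
    children up to order, the multiset can be listed so that they match. *)
Lemma mem_decomps r t (D : {mset (tree m * cut)}) :
  (D \in decomps r t) =
  perm_eq (map fst D) (children t) && all (fun p => p.2 \in r p.1) D.
Proof.
have zipP (L : seq (tree m * cut)) :
    (unzip2 L \in selections [seq enum_fset (r u) | u <- unzip1 L]) =
    all (fun p => p.2 \in r p.1) L.
  by rewrite selectionsP; elim: L => //= p L ->.
apply/imfsetP/andP => [[c /= cs ->]|[eD rD]].
  have ec : size c = size (children t).
    by move: cs; rewrite selectionsP all2E size_map => /andP[/eqP].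
  rewrite (perm_all _ (perm_eq_seq_mset _)) -zipP.
  rewrite unzip2_zip ?ec // unzip1_zip ?ec //; split=> //.
  apply: perm_trans (perm_map _ (perm_eq_seq_mset _)) _.
  by rewrite -/(unzip1 _) unzip1_zip ?ec.
(* Such a listing exists, since a count of zero would make [multfact (children t)] zero. *)
have : (0 < count (fun L => map fst L == children t) (permutations D))%N.
  rewrite lt0n; apply/eqP => e0; move: (count_permutations_map eD).
  by rewrite e0 mul0n => e1; move: (multfact_gt0 (children t)); rewrite -e1.
rewrite -has_count => /hasP[L]; rewrite mem_permutations => LD /eqP Lt.
exists (unzip2 L) => /=; first by rewrite -Lt zipP // (perm_all _ LD).
rewrite -Lt zip_unzip -{1}(seq_mset_id D).
by apply/eq_seq_msetP; rewrite perm_sym.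
Qed.

(** The division in [multinom] is exact, its quotient being the number of orderings of [D] that lie
    over [children t]. *)
Lemma multinomM r t (D : {mset (tree m * cut)}) : D \in decomps r t ->
  (multinom t D * multfact D = multfact (children t))%N.
Proof.
rewrite mem_decomps => /andP[e _]; rewrite /multinom -/(multfact _).
have -> : (\prod_(p <- finsupp D) (D p)`! = multfact D)%N.
  rewrite /multfact (perm_big _ (perm_undup_mset D)).
  by apply: eq_bigr => p _; rewrite count_mem_mset.
by rewrite -(count_permutations_map e) mulnK // multfact_gt0.
Qed.

End MemDecomps.

(** * Symmetry of second derivatives *)

Section Schwarz.
Variables (R : realType) (V : normedModType R).
Implicit Types (f : V -> R) (x u v : V).

Lemma is_derive_line f x u (s : R) : differentiable f (x + s *: u) ->
  is_derive s (1 : R) (fun r : R => f (x + r *: u)) ('D_u f (x + s *: u)).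
Proof.
move=> df.
have E : (fun h : R => h^-1 *: (((fun r : R => f (x + r *: u)) \o shift s) (h *: 1) - f (x + s *: u)))
  = (fun h : R => h^-1 *: ((f \o shift (x + s *: u)) (h *: u) - f (x + s *: u))).
  apply/funext => h /=; congr (_ *: (f _ - _)).
  by rewrite [h *: 1]mulr1 scalerDl addrCA.
apply: DeriveDef; last by rewrite /derive E.
rewrite /derivable E; exact: diff_derivable.
Qed.

Lemma diff_eps f x (e : R) : 0 < e -> differentiable f x ->
  exists2 r : R, 0 < r & forall z, `|z| < r ->
    `|f (x + z) - f x - 'D_z f x| <= e * `|z|.
Proof.
move=> e0 df; have /eqaddoP := diff_locally df.
move=> /(_ e e0) /nbhs_normP[r r0 rP]; exists r => // z zr.
have /= := rP z; rewrite /= sub0r normrN => /(_ zr).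
rewrite -[X in `|X|]/(f (z + x) - (f x + 'd f x z)).
by rewrite deriveE // opprD addrA (addrC x).
Qed.

(** The mean value theorem for [f (x + h *: v + s *: u) - f (x + s *: u)] as a function of [s] in
    [0, h] turns the second difference into [h] times an increment of ['D_u f], which is estimated
    by differentiability at [x]. *)
Lemma second_difference f x u v (e : R) : 0 < e ->
  (forall y, differentiable f y) -> differentiable ('D_u f) x ->
  exists2 r : R, 0 < r & forall h : R, 0 < h < r ->
    `|f (x + h *: u + h *: v) - f (x + h *: u) - f (x + h *: v) + f x
      - h ^+ 2 * 'D_v ('D_u f) x| <= e * h ^+ 2.
Proof.
(* For [0 < c < h] the norms of [h *: v + c *: u] and [c *: u] add up to at most [h * M]; the
   summand 1 keeps [M] positive. *)
move=> e0 df dDf; pose M := 2 * `|u| + `|v| + 1.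
have M0 : 0 < M by rewrite ltr_wpDl // addr_ge0 // mulr_ge0.
have [r r0 rP] := diff_eps (divr_gt0 e0 M0) dDf.
exists (r / M); first exact: divr_gt0.
move=> h /andP[h0 hr]; rewrite ltr_pdivlMr // in hr.
pose p (s : R) := f (x + h *: v + s *: u) - f (x + s *: u).
pose dp (s : R) := 'D_u f (x + h *: v + s *: u) - 'D_u f (x + s *: u).
have pP (s : R) : is_derive s 1 p (dp s).
  by apply: is_deriveB; apply: is_derive_line.
have pc : {within `[0, h], continuous p}.
  apply: continuous_subspaceT => s; apply: differentiable_continuous.
  by apply/derivable1_diffP; apply: ex_derive.
have [c /itvP cP pE] := MVT h0 (fun s _ => pP s) pc.
have -> : f (x + h *: u + h *: v) - f (x + h *: u) - f (x + h *: v) + f x = p h - p 0.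
  by rewrite /p scale0r !addr0 opprB addrA (addrAC x); ring.
rewrite pE subr0 {pE}; have c0 : 0 < c by rewrite cP. have ch : c < h by rewrite cP.
have z1 : `|h *: v + c *: u| <= h * (`|u| + `|v|).
  rewrite (le_trans (ler_normD _ _)) // !normrZ !gtr0_norm // mulrDr addrC.
  by rewrite lerD2r ler_wpM2r // ltW.
have z2 : `|c *: u| <= h * `|u|.
  by rewrite normrZ gtr0_norm // ler_wpM2r // ltW.
have hM : h * (`|u| + `|v|) + h * `|u| <= h * M.
  by rewrite -mulrDr ler_wpM2l ?(ltW h0) // /M; lra.
have hMr := le_lt_trans hM hr.
have r1 := rP _ (le_lt_trans z1 (le_lt_trans _ hMr)).
have {}r1 := r1 ltac:(by rewrite lerDl mulr_ge0 // ltW).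
have r2 := rP _ (le_lt_trans z2 (le_lt_trans _ hMr)).
have {}r2 := r2 ltac:(by rewrite lerDr mulr_ge0 ?addr_ge0 // ltW).
have DE : 'D_(h *: v + c *: u) ('D_u f) x = h * 'D_v ('D_u f) x + 'D_(c *: u) ('D_u f) x.
  by rewrite !deriveE // linearD linearZ.
set D2 := 'D_v ('D_u f) x in DE *; set D3 := 'D_(c *: u) ('D_u f) x in DE r2.
have dpE : `|dp c - h * D2| <= e * h.
  have -> : dp c - h * D2 =
    ('D_u f (x + (h *: v + c *: u)) - 'D_u f x - (h * D2 + D3))
    - ('D_u f (x + c *: u) - 'D_u f x - D3) by rewrite /dp addrA; ring.
  rewrite (le_trans (ler_normB _ _)) // -DE (le_trans (lerD r1 r2)) //.
  rewrite -mulrDr -mulrA ler_wpM2l ?(ltW e0) // mulrC ler_pdivrMr //.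
  exact: le_trans (lerD z1 z2) hM.
have -> : dp c * h - h ^+ 2 * D2 = h * (dp c - h * D2) by ring.
by rewrite normrM gtr0_norm // expr2 mulrCA ler_pM2l.
Qed.

(** The second difference is symmetric in [u] and [v], so for small [h] both mixed derivatives,
    times [h ^+ 2], lie within [e / 2 * h ^+ 2] of it. *)
Lemma derive_comm_real f x u v : (forall y, differentiable f y) ->
  differentiable ('D_u f) x -> differentiable ('D_v f) x ->
  'D_u ('D_v f) x = 'D_v ('D_u f) x.
Proof.
move=> df du dv; apply/eqP; rewrite -subr_eq0 -normr_le0.
apply/ler_addgt0Pl => e e0; rewrite addr0.
have e2 : 0 < e / 2 by rewrite divr_gt0.
have [r1 r10 r1P] := second_difference v e2 df du.
have [r2 r20 r2P] := second_difference u e2 df dv.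
pose h := Num.min r1 r2 / 2.
have m0 : 0 < Num.min r1 r2 by rewrite lt_min r10 r20.
have h0 : 0 < h by rewrite divr_gt0.
have hm : h < Num.min r1 r2 by rewrite /h ltr_pdivrMr // mulr_natr mulr2n ltrDl.
have := r1P h; rewrite h0 (lt_le_trans hm) ?ge_min ?lexx // => /(_ isT) a1.
have := r2P h; rewrite h0 (lt_le_trans hm) ?ge_min ?lexx ?orbT // => /(_ isT) a2.
rewrite -(ler_pM2l (exprn_gt0 2 h0)) -[X in X * `|_|]gtr0_norm ?exprn_gt0 //.
rewrite -normrM.
set A := 'D_u _ _ in a2 *; set B := 'D_v _ _ in a1 *.
have -> : h ^+ 2 * (A - B) =
 (f (x + h *: u + h *: v) - f (x + h *: u) - f (x + h *: v) + f x - h ^+ 2 * B)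
 - (f (x + h *: v + h *: u) - f (x + h *: v) - f (x + h *: u) + f x - h ^+ 2 * A).
  by rewrite (addrAC x (h *: v)); ring.
rewrite (le_trans (ler_normB _ _)) // (le_trans (lerD a1 a2)) //.
by rewrite -mulrDl -splitr mulrC.
Qed.

End Schwarz.

(** * Iterated derivatives and the expansion of multilinear maps *)

Section IteratedDerivatives.
Variables (R : realType) (d : nat).
Local Notation V := 'rV[R]_d.
Implicit Types (f : V -> V) (s vs : seq V).

Lemma differentiable_entry f x i j : differentiable f x ->
  differentiable (fun y => f y i j : R) x.
Proof. by move=> df; apply: differentiable_comp df (differentiable_coord _ _ _). Qed.

Lemma derive_entry f x v i j : differentiable f x ->
  'D_v f x i j = 'D_v (fun y => f y i j : R) x.
Proof. by move=> df; rewrite derive_mx ?mxE //; apply: diff_derivable. Qed.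

Lemma derive_comm f x (u v : V) : (forall y, differentiable f y) ->
  (forall y, differentiable ('D_u f) y) -> (forall y, differentiable ('D_v f) y) ->
  'D_u ('D_v f) x = 'D_v ('D_u f) x.
Proof.
move=> df du dv; apply/matrixP => i j.
have E w : (fun y => 'D_w f y i j) = 'D_w (fun y => f y i j : R).
  by apply/funext => y; apply: derive_entry.
have eu := derive_entry v i j (du x); rewrite E in eu.
have ev := derive_entry u i j (dv x); rewrite E in ev.
apply: etrans ev (etrans _ (esym eu)).
apply: derive_comm_real => [y||]; first exact: differentiable_entry.
  by rewrite -E; apply: differentiable_entry.
by rewrite -E; apply: differentiable_entry.
Qed.

Lemma iterD_move f s1 v s2 : smooth f ->
  iterD f (s1 ++ v :: s2) = iterD f (v :: s1 ++ s2).
Proof.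
move=> fs; elim: s1 => //= u s1 ->; apply/funext => x.
apply: derive_comm => y; first exact: fs (s1 ++ s2) y.
  exact: fs (u :: s1 ++ s2) y.
exact: fs (v :: s1 ++ s2) y.
Qed.

Lemma iterD_perm f s1 s2 : smooth f -> perm_eq s1 s2 -> iterD f s1 = iterD f s2.
Proof.
move=> fs; elim: s1 s2 => [|v s1 IH] s2.
  by rewrite perm_sym => /perm_nilP ->.
move=> e; have vs2 : v \in s2 by rewrite -(perm_mem e) mem_head.
case/splitPr: vs2 e => a b e; rewrite iterD_move //=.
rewrite (IH (a ++ b)) //; rewrite -(perm_cons v) (permPl e).
by rewrite -cat1s -(cat1s v (a ++ b)) perm_catCA.
Qed.

Definition multilinear (M : seq V -> V) := forall s1 s2 (a : R) (u v : V),
  M (s1 ++ (a *: u + v) :: s2) = a *: M (s1 ++ u :: s2) + M (s1 ++ v :: s2).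

Lemma iterD_multilinear f x : smooth f -> multilinear (fun vs => iterD f vs x).
Proof.
move=> fs s1 s2 a u v; rewrite !iterD_move //=.
have df := fs (s1 ++ s2) x.
by rewrite (deriveE _ df) (deriveE u df) (deriveE v df) linearP.
Qed.

Lemma multilinear_cons M v : multilinear M -> multilinear (fun vs => M (v :: vs)).
Proof. by move=> Ml s1 s2 a u w; rewrite -!cat_cons Ml. Qed.

Lemma multilinear_sum M X (S : seq X) (P : pred X) (c : X -> R) (v : X -> V) vs :
  multilinear M ->
  M ((\sum_(p <- S | P p) c p *: v p) :: vs) =
  \sum_(p <- S | P p) c p *: M (v p :: vs).
Proof.
move=> Ml; have M0 : M (0 :: vs) = 0.
  have := Ml [::] vs (-1) 0 0; rewrite /= scaler0 addr0 scaleN1r => ->.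
  by rewrite addNr.
elim: S => [|p S IH]; rewrite ?big_nil ?big_cons //.
by case: ifP => // _; rewrite -IH; apply: (Ml [::]).
Qed.

Lemma multilin_fs_sum (Vs : seq (nat -> V)) n X (S : seq X) (P : pred X)
    (c : X -> R) (M : X -> seq V -> V) :
  multilin_fs (fun vs => \sum_(p <- S | P p) c p *: M p vs) Vs n =
  \sum_(p <- S | P p) c p *: multilin_fs (M p) Vs n.
Proof.
elim: Vs n M => [|W Vs IH] n M /=.
  by case: eqP => // _; rewrite big1 // => p _; rewrite scaler0.
under eq_bigr => i _ do rewrite IH.
by rewrite exchange_big; apply: eq_bigr => p _; rewrite scaler_sumr.
Qed.

(** Multiplying out: a choice of one graded term per argument contributes to order [n] when its
    degrees add up to [n]. The arguments enter up to order [n] only, so truncated lists of terms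
    suffice. *)
Lemma multilin_fs_expand (X Y : eqType) (ks : seq Y) (Vf : Y -> nat -> V)
    (Sf : Y -> seq X) (deg : X -> nat) (c : X -> R) (v : X -> V) M n :
  multilinear M ->
  {in ks, forall k i, (i <= n)%N ->
     Vf k i = \sum_(p <- Sf k | deg p == i) c p *: v p} ->
  multilin_fs M (map Vf ks) n =
  \sum_(L <- selections (map Sf ks) | (\sum_(p <- L) deg p)%N == n)
     (\prod_(p <- L) c p) *: M (map v L).
Proof.
elim: ks n M => [|k ks IH] n M Ml VE /=.
  by rewrite big_cons !big_nil eq_sym scale1r addr0.
have {}IH i p : (i <= n)%N ->
    multilin_fs (fun vs => M (v p :: vs)) (map Vf ks) (n - i) =
    \sum_(L <- selections (map Sf ks) | (\sum_(p <- L) deg p)%N == (n - i)%N)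
      (\prod_(p <- L) c p) *: M (v p :: map v L).
  move=> ni; apply: IH; first exact: multilinear_cons.
  move=> k' k's j jn; apply: VE; first by rewrite inE k's orbT.
  exact: leq_trans jn (leq_subr _ _).
transitivity (\sum_(i < n.+1) \sum_(p <- Sf k | deg p == i)
   \sum_(L <- selections (map Sf ks) | (\sum_(p <- L) deg p)%N == (n - i)%N)
   (c p * \prod_(p <- L) c p) *: M (v p :: map v L)).
  apply: eq_bigr => i _; have ni : (i <= n)%N by rewrite -ltnS.
  have -> : (fun vs => M (Vf k i :: vs)) =
            (fun vs => \sum_(p <- Sf k | deg p == i) c p *: M (v p :: vs)).
    by apply/funext => vs; rewrite VE ?mem_head // multilinear_sum.
  rewrite multilin_fs_sum; apply: eq_bigr => p _; rewrite IH // scaler_sumr.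
  by apply: eq_bigr => L _; rewrite scalerA.
rewrite [RHS]big_mkcond big_allpairs_dep /= (exchange_big_dep predT) //=.
apply: eq_bigr => p _; rewrite -[RHS]big_mkcond /=.
have [pn|pn] := ltnP (deg p) n.+1; last first.
  rewrite big1 => [|i /eqP e]; last by move: (ltn_ord i); rewrite -e ltnNge pn.
  rewrite big1_seq // => L /andP[]; rewrite big_cons => /eqP e.
  by move: pn; rewrite -e ltnNge leq_addr.
rewrite (big_pred1 (Ordinal pn)) => [|i]; last by rewrite /= -val_eqE eq_sym.
apply: eq_big => [L|L _]; last by rewrite big_cons.
by rewrite /= big_cons -{2}(subnKC (n := n) (m := deg p)) ?eqn_add2l.
Qed.

End IteratedDerivatives.

(** * Enumeration of trees and cuts, and bounds on their orders *)

Section TreeEnumeration.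
Variable m : nat.
Local Notation cut := (T m * {mset T m})%type.
Implicit Types (t u : tree m) (n N : nat).

Lemma order_gt0 t : (0 < order t)%N.
Proof. by rewrite order_children. Qed.

Lemma finite_orderT_le N : finite_set [set tau : T m | (orderT tau <= N)%N].
Proof.
elim: N => [|N IH].
  by apply: sub_finite_set (finite_orderT m 0) => tau /=; rewrite leqn0 => /eqP.
apply: (@sub_finite_set _ _ ([set tau : T m | (orderT tau <= N)%N] `|`
                             [set tau : T m | orderT tau = N.+1])).
  by move=> tau /=; rewrite leq_eqVlt ltnS => /orP[/eqP|]; [right|left].
by rewrite finite_setU; split=> //; apply: finite_orderT.
Qed.

Definition trees_le N : seq (tree m) :=
  pmap id (fset_set [set tau : T m | (orderT tau <= N)%N]).

Definition trees n : seq (tree m) := [seq t <- trees_le n | order t == n].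

Lemma mem_trees_le N t : (t \in trees_le N) = (order t <= N)%N.
Proof.
rewrite mem_pmap map_id in_fset_set; last exact: finite_orderT_le.
by apply/idP/idP; rewrite inE.
Qed.

Lemma trees_le_uniq N : uniq (trees_le N).
Proof. by apply: (@pmap_uniq _ _ id Some); [case | exact: fset_uniq]. Qed.

Lemma mem_trees n t : (t \in trees n) = (order t == n).
Proof.
by rewrite mem_filter mem_trees_le; case: eqP => // ->; rewrite leqnn.
Qed.

Lemma trees_uniq n : uniq (trees n).
Proof. exact/filter_uniq/trees_le_uniq. Qed.

Lemma filter_trees_le n N : (n <= N)%N ->
  perm_eq [seq t <- trees_le N | order t == n] (trees n).
Proof.
move=> nN; apply: uniq_perm; rewrite ?trees_uniq ?filter_uniq ?trees_le_uniq //.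
move=> t; rewrite mem_trees mem_filter mem_trees_le.
by case: eqP => // ->; rewrite nN.
Qed.

Lemma sum_order0 (V : nmodType) (G : T m -> V) :
  \sum_(tau \in [set tau : T m | orderT tau = 0%N]) G tau = G None.
Proof.
rewrite (_ : [set tau : T m | _] = [set None]) ?fsbig_set1 //.
apply/seteqP; split => [[t|]|tau ->] //= /eqP.
by rewrite eqn0Ngt order_gt0.
Qed.

Lemma sum_order (V : nmodType) (G : T m -> V) n : (0 < n)%N ->
  \sum_(tau \in [set tau : T m | orderT tau = n]) G tau =
  \sum_(t <- trees n) G (Some t).
Proof.
move=> n0; rewrite fsbig_finite /=; last exact: finite_orderT.
rewrite -(big_map Some predT G); apply: perm_big; apply: uniq_perm; first exact: fset_uniq.
  by rewrite map_inj_uniq ?trees_uniq // => ? ? [].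
move=> tau; rewrite in_fset_set; last exact: finite_orderT.
apply/idP/mapP => [|[t]]; rewrite inE /=.
  case: tau => [t /eqP tn|n00]; first by exists t; rewrite ?mem_trees.
  by rewrite -n00 in n0.
by rewrite mem_trees => /eqP tn ->.
Qed.

(** The truncation at [N] gives one finite list that serves all orders up to [N]. *)
Definition cuts_le N : seq (tree m * cut) :=
  [seq (u, c) | u <- trees_le N, c <- enum_fset (ST_tree u)].

Lemma mem_cuts_le N (p : tree m * cut) :
  (p \in cuts_le N) = (order p.1 <= N)%N && (p.2 \in ST_tree p.1).
Proof.
apply/allpairsPdep/andP => [[u [c [uN cu ->]]]|[pN pS]].
  by rewrite -mem_trees_le.
by exists p.1, p.2; rewrite mem_trees_le -surjective_pairing.
Qed.

Lemma cuts_le_uniq N : uniq (cuts_le N).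
Proof.
apply: allpairs_uniq_dep => [|u _|]; rewrite ?trees_le_uniq ?fset_uniq //.
by move=> [u c] [u' c'] _ _ /= [-> ->].
Qed.

Lemma sum_cuts_le (V : nmodType) (G : tree m * cut -> V) (tau : T m) n N :
  (n <= N)%N ->
  \sum_(p <- cuts_le N | (p.2.1 == tau) && (order p.1 == n)) G p =
  \sum_(u <- trees n) \sum_(c <- ST_tree u | c.1 == tau) G (u, c).
Proof.
move=> nN; rewrite big_mkcond big_allpairs_dep /=.
rewrite -(perm_big _ (filter_trees_le nN)) big_filter [RHS]big_mkcond.
apply: eq_bigr => u _; rewrite -big_mkcond /=.
by case: eqP => _; [apply: eq_bigl => c; rewrite andbT | apply: big1 => c; rewrite andbF].
Qed.

Lemma trunkE l (D : {mset (tree m * cut)}) :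
  trunk l D = Some (node l (pmap id [seq p.2.1 | p <- D])).
Proof. by []. Qed.

Lemma ST_treeP u (c : cut) : reflect
  (c = (None, [mset Some u]) \/
   exists2 D, D \in decomps (@ST_tree m) u & c = (trunk (root u) D, remainder D))
  (c \in ST_tree u).
Proof.
rewrite ST_treeE; apply: (iffP (fset1UP _ _ _)) => -[->|]; try by left.
  by case/imfsetP => D /= Du ->; right; exists D.
by case=> D Du ->; right; apply/imfsetP; exists D.
Qed.

Lemma sum_orderT_pmap (s : seq (T m)) :
  (\sum_(t <- pmap id s) order t = \sum_(tau <- s) orderT tau)%N.
Proof.
elim: s => [|[t|] s IH] /=; rewrite ?big_nil ?big_cons ?IH //.
Qed.

Lemma order_node l s : order (node l s) = (\sum_(t <- s) @order m t).+1.
Proof. by rewrite order_children (perm_big _ (children_node l s)). Qed.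

Lemma order_trunk l (D : {mset (tree m * cut)}) :
  orderT (trunk l D) = (\sum_(p <- D) orderT p.2.1).+1.
Proof. by rewrite trunkE /= order_node sum_orderT_pmap big_map. Qed.

Lemma order_decomps r u (D : {mset (tree m * cut)}) : D \in decomps r u ->
  order u = (\sum_(p <- D) order p.1).+1.
Proof.
rewrite mem_decomps order_children => /andP[e _].
by rewrite -(perm_big _ e) big_map.
Qed.

Lemma order_decomps_lt r u (D : {mset (tree m * cut)}) p :
  D \in decomps r u -> p \in D -> (order p.1 < order u)%N.
Proof. by move=> Du pD; apply: order_child; apply: decomps_child Du pD. Qed.

Lemma ST_tree_order u (c : cut) : c \in ST_tree u ->
  (orderT c.1 <= order u)%N.
Proof.
have [n] := ubnP (order u); elim: n u c => // n IH u c un.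
case/ST_treeP => [->|[D Du ->]]; first by [].
rewrite -[(_, _).1]/(trunk (root u) D) order_trunk (order_decomps Du) ltnS big_seq [leqRHS]big_seq.
apply: leq_sum => p pD; apply: IH.
  exact: leq_trans (order_decomps_lt Du pD) un.
by move: Du; rewrite mem_decomps => /andP[_ /allP]; apply.
Qed.

Lemma in_remainder (D : {mset (tree m * cut)}) delta : delta \in remainder D ->
  delta = None \/ exists2 p, p \in D & delta \in (p.2.2 : {mset T m}).
Proof.
rewrite /remainder; case: eqP => [_|_]; first by rewrite in_mset1 => /eqP; left.
have big_in (s : seq (tree m * cut)) : delta \in \big[@msetD _/mset0]_(p <- s) p.2.2 ->
    exists2 p, p \in s & delta \in (p.2.2 : {mset T m}).
  elim: s => [|p s IH]; first by rewrite big_nil in_mset0.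
  rewrite big_cons in_msetD => /orP[dp|/IH[q qs dq]].
    by exists p; rewrite ?mem_head.
  by exists q; rewrite ?inE ?qs ?orbT.
by move=> /big_in; right.
Qed.

Lemma ST_tree_remainder_le u (c : cut) delta : c \in ST_tree u ->
  delta \in c.2 -> (orderT delta <= order u)%N.
Proof.
have [n] := ubnP (order u); elim: n u c => // n IH u c un.
case/ST_treeP => [->|[D Du ->]] /=; first by rewrite in_mset1 => /eqP ->.
case/in_remainder => [-> //|[p pD dp]].
have pu := order_decomps_lt Du pD.
apply: leq_trans (ltnW pu); apply: IH dp; first exact: leq_trans pu un.
by move: Du; rewrite mem_decomps => /andP[_ /allP]; apply.
Qed.

(** A nonempty subtree keeps the root of [u], so a remaining tree is empty or left over in a child
    of [u]. This makes the recursion for [Phi] well founded. *)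
Lemma ST_tree_remainder_lt u (c : cut) delta : c \in ST_tree u -> c.1 != None ->
  delta \in c.2 -> (orderT delta < order u)%N.
Proof.
case/ST_treeP => [->|[D Du ->]] //= _.
case/in_remainder => [-> //|[p pD dp]]; first exact: order_gt0.
apply: leq_ltn_trans (order_decomps_lt Du pD).
apply: ST_tree_remainder_le dp.
by move: Du; rewrite mem_decomps => /andP[_ /allP]; apply.
Qed.

Lemma perm_pmap_id (s : seq (T m)) :
  perm_eq s (nseq (count_mem None s) None ++ map Some (pmap id s)).
Proof.
elim: s => [|[t|] s IH] //=; last by rewrite perm_cons.
by rewrite perm_sym -cat1s perm_catCA /= perm_cons perm_sym.
Qed.

(** The value 1 at the empty tree accounts for the remainder [{emptyset}] of a single vertex, which
    faces an empty product on the right. *)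
Lemma big_remainder (R : comPzRingType) (a : T m -> R) (D : {mset (tree m * cut)}) :
  a None = 1 ->
  \prod_(delta <- remainder D) a delta =
  \prod_(p <- D) \prod_(delta <- (p.2.2 : {mset T m})) a delta.
Proof.
move=> a1; rewrite /remainder; case: eqP => [->|_].
  by rewrite enum_mset0 big_nil enum_msetn big_seq1.
elim: (D : seq _) => [|p s IH]; first by rewrite !big_nil enum_mset0 big_nil.
rewrite !big_cons -IH -big_cat; apply: perm_big.
by apply/allP => t _ /=; rewrite count_cat !count_mem_mset msetE2.
Qed.

End TreeEnumeration.

(** * Elementary differentials at a formal B-series *)

Lemma sum_only1 (X : eqType) (W : nmodType) (r : seq X) (P : pred X)
    (f : X -> W) x : uniq r -> x \in r -> P x -> {in r, forall y, P y -> y = x} ->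
  \sum_(y <- r | P y) f y = f x.
Proof.
move=> ru xr Px PE; rewrite -big_filter (perm_big [:: x]) ?big_seq1 //.
apply: uniq_perm; rewrite ?filter_uniq // => y; rewrite mem_filter inE.
by apply/andP/eqP => [[Py /PE->]|->].
Qed.

Section ElementaryDifferentialsAtSeries.
Variables (R : realType) (m d : nat).
Local Notation V := 'rV[R]_d.
Local Notation cut := (T m * {mset T m})%type.
Local Notation decomposition := {mset (tree m * cut)}.
Variable g : 'I_m.+1 -> V -> V.
Hypothesis g_smooth : forall l, smooth (g l).
Variables (x0 : V) (a : T m -> R).
Hypothesis a_empty : a None = 1.
Implicit Types (t u : tree m) (p : tree m * cut).

Local Notation F t := (elem_diff_tree g t x0).

Lemma alpha_tree_neq0 t : alpha_tree t != 0 :> R.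
Proof.
have [n] := ubnP (order t); elim: n t => // n IH t tn.
rewrite alpha_treeE mulf_neq0 ?invr_eq0 //.
  by rewrite -natr_prod pnatr_eq0 -lt0n multfact_gt0.
rewrite prodf_seq_neq0; apply/allP => u ut /=; apply: IH.
exact: leq_trans (order_child ut) tn.
Qed.

(** [node] sorts its subtrees, which the symmetry of the derivatives makes harmless. *)
Lemma elem_diff_node l s : F (node l s) = iterD (g l) (map (fun u => F u) s) x0.
Proof.
rewrite elem_diff_treeE root_node.
by rewrite (iterD_perm (g_smooth l) (perm_map _ (children_node l s))).
Qed.

(** The coefficient of [F u] that the cut [p.2] of [u = p.1] contributes to
    [alpha(theta) F(theta)(Z)]. *)
Definition weight p : R := alpha_tree p.1 * (gamma_tree p.1 p.2.1 p.2.2)%:R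
  * \prod_(delta <- (p.2.2 : {mset T m})) a delta.

(** The only cut with empty subtree is [(emptyset, {u})], and its [gamma] is 1. *)
Lemma sum_weight_empty u :
  \sum_(c <- ST_tree u | c.1 == None) weight (u, c) = alpha_tree u * a (Some u).
Proof.
rewrite (@sum_only1 _ _ _ _ _ (None, [mset Some u])) ?fset_uniq //.
- by rewrite /weight /= gamma_treeE eqxx mulr1 enum_msetn big_seq1.
- by apply/ST_treeP; left.
- by move=> c /ST_treeP[//|[D _ ->]].
Qed.

(* [alpha u * multinom u D = alpha u_1 ... alpha u_k / multfact D]. *)
Lemma sum_weight u t :
  \sum_(c <- ST_tree u | c.1 == Some t) weight (u, c) =
  \sum_(D <- decomps (@ST_tree m) u | trunk (root u) D == Some t)
    (multfact (D : decomposition))%:R^-1 * \prod_(p <- (D : decomposition)) weight p.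
Proof.
transitivity (\sum_(c <- ST_tree u | c.1 == Some t)
  \sum_(D <- decomps (@ST_tree m) u | (trunk (root u) D == Some t) && (remainder D == c.2))
    (multfact (D : decomposition))%:R^-1 * \prod_(p <- (D : decomposition)) weight p).
  apply: eq_bigr => c /eqP ct; rewrite /weight /= ct gamma_treeE.
  rewrite natr_sum mulr_sumr mulr_suml big_seq_cond [RHS]big_seq_cond.
  apply: eq_bigr => D /andP[Du /andP[_ /eqP <-]].
  rewrite big_remainder // natrM natr_prod !big_split /=.
  rewrite alpha_treeE -natr_prod -/(multfact _) -(multinomM Du).
  have := Du; rewrite mem_decomps => /andP[e _].
  rewrite -(perm_big _ e) big_map natrM invfM.
  set x := (multinom _ _)%:R; have x0' : x != 0.
    rewrite pnatr_eq0 -lt0n; have := multfact_gt0 (children u).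
    by rewrite -(multinomM Du) muln_gt0 => /andP[].
  by field; rewrite x0' pnatr_eq0 -lt0n multfact_gt0.
(* Each [D] with trunk [t] is met at the single cut [(t, remainder D)]. *)
rewrite (exchange_big_dep (fun D => trunk (root u) D == Some t)) /=; last first.
  by move=> c D _ /andP[].
rewrite big_seq_cond [RHS]big_seq_cond; apply: eq_bigr => D /andP[Du /eqP Dt].
rewrite (@sum_only1 _ _ _ _ _ (Some t, remainder D)) ?fset_uniq ?Dt ?eqxx //.
  by apply/ST_treeP; right; exists D; rewrite ?Dt.
by move=> [c1 c2] _ /= /andP[/eqP -> /eqP ->].
Qed.

Variable Z : nat -> V.
Hypothesis Z0 : Z 0%N = x0.
Hypothesis ZE : forall n, (0 < n)%N ->
  Z n = \sum_(t <- trees m n) (alpha_tree t * a (Some t)) *: F t.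

Let dZ n := if n == 0%N then 0 else Z n.

(** The case of the empty subtree in the expansion, for the argument [Z - x0] of Taylor's formula;
    at order 0 both sides vanish, as every nonempty tree has a vertex. *)
Lemma dZ_sum n N : (n <= N)%N ->
  dZ n = \sum_(p <- cuts_le m N | (p.2.1 == None) && (order p.1 == n)) weight p *: F p.1.
Proof.
move=> nN; rewrite sum_cuts_le // /dZ; case: eqP => [->|/eqP n0].
  rewrite big1_seq // => u /=; rewrite mem_trees => /eqP e.
  by move: (order_gt0 u); rewrite e.
rewrite ZE ?lt0n //; apply: eq_bigr => u _ /=.
by rewrite -scaler_suml sum_weight_empty.
Qed.

(* A list [L] of triples [(u_i, theta_i, omega_i)] whose second components are
   the arguments of a term of Taylor's formula assembles into the tree
   [node l (map fst L)]; the lists with the same multiset [D] are counted by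
   [count_permutations_map], which turns [1 / multfact ks] into [1 / multfact D]. *)
Lemma sum_selections (w : tree m * cut -> R) N u t i :
  (order u <= N)%N ->
  let ks := nseq i None ++ map Some (children t) in
  \sum_(L <- selections [seq [seq p <- cuts_le m N | p.2.1 == k] | k <- ks]
          | node (root t) (map fst L) == u)
    ((multfact ks)%:R^-1 * \prod_(p <- L) w p) =
  \sum_(D <- decomps (@ST_tree m) u
          | (trunk (root u) D == Some t) && (size (D : decomposition) == i + size (children t))%N)
    (multfact (D : decomposition))%:R^-1 * \prod_(p <- (D : decomposition)) w p.
Proof.
move=> uN ks; have [rut|rut] := eqVneq (root u) (root t); last first.
  rewrite !big1 // => [D|L /eqP Lu]; last by rewrite -Lu root_node eqxx in rut.
  case/andP => /eqP[Dt _]; by rewrite -Dt root_node eqxx in rut.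
have ksn : (count_mem None ks = i)%N.
  rewrite count_cat count_nseq /= mul1n count_map (eq_count (a2 := pred0)) //.
  by rewrite count_pred0 addn0.
have ksp : pmap id ks = children t.
  by rewrite pmap_cat; elim: (i) => //=; elim: (children t) => //= v s ->.
have sks : (size ks = i + size (children t))%N by rewrite size_cat size_nseq size_map.
rewrite -[LHS]big_filter -[RHS]big_filter.
rewrite (@sum_over_msets _ _ (fun p => p.2.1) ks _
  (fun L => (multfact ks)%:R^-1 * \prod_(p <- L) w p) _
  [seq D <- decomps (@ST_tree m) u | (trunk (root u) D == Some t) &&
     (size (D : decomposition) == i + size (children t))%N]).
- rewrite big_seq [RHS]big_seq; apply: eq_bigr => D.
  rewrite mem_filter => /andP[/andP[/eqP Dt /eqP sD] Du].
  (* The trunk determines the nonempty subtrees, and the size then the number of empty ones. *)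
  have e : perm_eq [seq p.2.1 | p <- (D : decomposition)] ks.
    have pt : perm_eq (pmap id [seq p.2.1 | p <- (D : decomposition)]) (children t).
      move: Dt => [<-]; rewrite perm_sym; exact: children_node.
    have pD := perm_pmap_id [seq p.2.1 | p <- (D : decomposition)].
    rewrite (permPl pD) /ks.
    have -> : count_mem None [seq p.2.1 | p <- (D : decomposition)] = i.
      have := perm_size pD; rewrite size_cat size_nseq !size_map (perm_size pt) sD.
      by move/addIn ->.
    by rewrite perm_cat2l perm_map.
  rewrite -(count_permutations_map e) natrM.
  rewrite -mulr_natr; set k := count _ _.
  have k0 : k%:R != 0 :> R.
    rewrite pnatr_eq0 -lt0n; have := multfact_gt0 ks.
    by rewrite -(count_permutations_map e) muln_gt0 => /andP[].
  by field; rewrite k0 pnatr_eq0 -lt0n multfact_gt0.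
- apply/filter_uniq/selections_uniq/allP => s /mapP[k _ ->].
  by rewrite filter_uniq ?cuts_le_uniq.
- exact/filter_uniq/fset_uniq.
- move=> L; rewrite mem_filter (@mem_fibre_selections _ _ (fun p : tree m * cut => p.2.1)).
  case/andP => /eqP Lu /andP[/allP Ls /eqP Lks]; split=> //.
  have eL := perm_eq_seq_mset L.
  rewrite mem_filter mem_decomps (perm_size eL) -(size_map (fun p : tree m * cut => p.2.1) L) Lks sks eqxx.
  rewrite trunkE (@node_perm m _ _ (children t)) ?rut ?node_children ?eqxx /=; last first.
    by rewrite -ksp -Lks; apply/perm_pmap/perm_map.
  apply/andP; split.
    apply: perm_trans (perm_map _ eL) _.
    by rewrite -Lu perm_sym children_node.
  by rewrite (perm_all _ eL); apply/allP => p /Ls; rewrite /= mem_cuts_le => /andP[].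
- move=> D; rewrite mem_filter => /andP[/andP[/eqP Dt _] Du] L LD Lks.
  rewrite mem_filter (@mem_fibre_selections _ _ (fun p : tree m * cut => p.2.1)) Lks eqxx andbT.
  have := Du; rewrite mem_decomps => /andP[e /allP DS].
  rewrite -rut (@node_perm m _ _ (children u)) ?node_children ?eqxx /=; last first.
    exact: perm_trans (perm_map _ LD) e.
  apply/allP => p; rewrite (perm_mem LD) => pD; rewrite /= mem_cuts_le DS // andbT.
  exact: leq_trans (ltnW (order_decomps_lt Du pD)) uN.
- by move=> L1 L2 e; rewrite (perm_big _ e).
Qed.

(** No subtree is larger than its child, and a child with empty subtree loses at least one vertex.
    So there are at most [order u - order t] empty subtrees, which bounds the Taylor index. *)
Lemma size_decomps_le u t D : D \in decomps (@ST_tree m) u ->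
  trunk (root u) D = Some t ->
  (size (children t) <= size (D : decomposition))%N /\
  (size (D : decomposition) - size (children t) <= order u - order t)%N.
Proof.
move=> Du Dt; have oD := order_trunk (root u) D.
have := Du; rewrite mem_decomps => /andP[_ /allP DS].
have sD : size (children t) = (\sum_(p <- (D : decomposition)) isSome p.2.1)%N.
  move: Dt => [<-]; rewrite (perm_size (children_node _ _)) size_pmap count_map.
  by rewrite -sum1_count big_mkcond; apply: eq_bigr => p _ /=; case: (isSome _).
have le1 : (\sum_(p <- (D : decomposition)) orderT p.2.1 + size (D : decomposition)
    <= \sum_(p <- (D : decomposition)) order p.1 + size (children t))%N.
  rewrite sD -sum1_size -!big_split /= big_seq [leqRHS]big_seq; apply: leq_sum => p /DS.
  move/ST_tree_order; case: (p.2.1) => [t'|] /=; first by rewrite leq_add2r.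
  by rewrite add0n addn0 order_gt0.
have le2 : (size (children t) <= size (D : decomposition))%N.
  by rewrite sD -sum1_size leq_sum // => p _; case: (isSome _).
by move: oD; rewrite Dt [orderT _]/= => ->; rewrite (order_decomps Du); lia.
Qed.

(** Taylor's formula at [t] is multiplied out over cuts: induction supplies the arguments at the
    children, [dZ_sum] the copies of [Z - x0]. The shift by [order t] is the factor [e ^ order t]
    that [elem_diff_tree_fs] leaves out. *)
Lemma elem_diff_tree_fs_sum N t j : (j + order t <= N)%N ->
  alpha_tree t *: elem_diff_tree_fs g Z t j =
  \sum_(p <- cuts_le m N | (p.2.1 == Some t) && (order p.1 == j + order t)%N)
     weight p *: F p.1.
Proof.
have [n] := ubnP (order t); elim: n t j => // n IH t j tn jN.
(* The arguments are the [F(theta_i)(Z)], whereas the weights belong to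
   [alpha(theta_i) F(theta_i)(Z)]; hence the division by [beta] in [c]. *)
pose beta (tau : T m) : R := if tau is Some t' then alpha_tree t' else 1.
have beta0 tau : beta tau != 0 by case: tau => [t'|] /=; rewrite ?alpha_tree_neq0 ?oner_eq0.
pose c p := weight p / beta p.2.1.
pose deg p := (order p.1 - orderT p.2.1)%N.
pose Vf (tau : T m) := if tau is Some t' then elem_diff_tree_fs g Z t' else dZ.
pose ks i := nseq i None ++ map Some (children t).
pose Sf k := [seq p <- cuts_le m N | p.2.1 == k].
have VE i : {in ks i, forall k n', (n' <= j)%N ->
    Vf k n' = \sum_(p <- Sf k | deg p == n') c p *: F p.1}.
  move=> k ki n' n'j; rewrite big_filter_cond.
  have dE : {in cuts_le m N, forall p, p.2.1 == k ->
      (deg p == n') = (order p.1 == n' + orderT k)%N}.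
    move=> p; rewrite mem_cuts_le => /andP[_ /ST_tree_order po] /eqP <-.
    by rewrite -(eqn_add2r (orderT p.2.1)) subnK.
  transitivity ((beta k)^-1 *: \sum_(p <- cuts_le m N
      | (p.2.1 == k) && (order p.1 == n' + orderT k)%N) weight p *: F p.1); last first.
    rewrite scaler_sumr big_seq_cond [RHS]big_seq_cond; apply: eq_big => p.
      by case pS: (p \in _) => //=; case kp: (p.2.1 == k) => //=; rewrite dE.
    by case/and3P => _ /eqP pk _; rewrite scalerA /c pk mulrC.
  case: k ki {dE} => [t'|] ki; last first.
    by rewrite invr1 scale1r addn0 -dZ_sum //; lia.
  have t't : t' \in children t.
    by move: ki; rewrite mem_cat mem_nseq /= andbF mem_map // => ? ? [].
  have ot := order_child t't.
  rewrite -IH; last by rewrite (leq_trans _ jN) // leq_add // ltnW.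
    by rewrite scalerA mulVf ?alpha_tree_neq0 // scale1r.
  exact: leq_trans ot tn.
set M := (j + order t)%N.
(* The Taylor index [i] becomes the number of empty subtrees in [D]. *)
transitivity (\sum_(i < j.+1) \sum_(u <- trees m M)
  (\sum_(D <- decomps (@ST_tree m) u
          | (trunk (root u) D == Some t) && (size (D : decomposition) == i + size (children t))%N)
    (multfact (D : decomposition))%:R^-1 * \prod_(p <- (D : decomposition)) weight p) *: F u).
  rewrite elem_diff_tree_fsE /taylor_fs scaler_sumr; apply: eq_bigr => i _.
  have -> : nseq i (fun i => if i == 0%N then 0 else Z i) ++
      [seq elem_diff_tree_fs g Z u | u <- children t] = map Vf (ks i).
    by rewrite map_cat map_nseq -map_comp.
  rewrite Z0 (multilin_fs_expand (iterD_multilinear x0 (g_smooth (root t))) (VE i)).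
  transitivity (\sum_(u <- trees m M)
     (\sum_(L <- selections (map Sf (ks i)) | node (root t) (map fst L) == u)
       ((multfact (ks i))%:R^-1 * \prod_(p <- L) weight p)) *: F u); last first.
    rewrite big_seq [RHS]big_seq; apply: eq_bigr => u; rewrite mem_trees => /eqP uM.
    by rewrite (@sum_selections _ N) // uM.
  under [RHS]eq_bigr => u _ do rewrite scaler_suml.
  rewrite (exchange_big_dep predT) //= !scaler_sumr big_mkcond.
  rewrite big_seq [RHS]big_seq; apply: eq_bigr => L.
  rewrite (@mem_fibre_selections _ _ (fun p : tree m * cut => p.2.1)).
  case/andP => /allP LS /eqP Lks.
  (* The subtrees in [L] have [order t - 1] vertices in all, so total degree [j] means that the
     assembled tree has [M] vertices. *)
  have -> : (\sum_(p <- L) deg p == j)%N = (order (node (root t) (map fst L)) == M).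
    rewrite order_node big_map /M order_children -(eqn_add2r (order t)).
    have -> : (\sum_(p <- L) deg p + order t = (\sum_(p <- L) order p.1).+1)%N.
      rewrite order_children addnS; congr _.+1.
      have -> : (\sum_(v <- children t) order v = \sum_(p <- L) orderT p.2.1)%N.
        rewrite -[RHS](big_map (fun p : tree m * cut => p.2.1) predT (@orderT m)) Lks.
        rewrite big_cat big_map /= big_nseq iter_addn_0 mul0n //.
      rewrite -big_split big_seq [RHS]big_seq; apply: eq_bigr => p /LS.
      by rewrite /= mem_cuts_le => /andP[_ /ST_tree_order]; apply: subnK.
    by rewrite -order_children.
  have [LM|LM] := eqVneq; last first.
    rewrite big1_seq // => u /andP[/eqP Lu]; rewrite mem_trees => /eqP uM.
    by rewrite Lu uM eqxx in LM.
  rewrite (@sum_only1 _ _ _ _ _ (node (root t) (map fst L))) ?trees_uniq ?mem_trees ?LM ?eqxx //;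
    last by move=> u _ /eqP.
  rewrite elem_diff_node -map_comp !scalerA; congr (_ *: _).
  (* Taylor's [i!] and the factorials in [alpha_tree t] combine to [multfact (ks i)]; the factors
     [alpha] of the children cancel against [beta]. *)
  rewrite /c big_split /= prodfV /ks multfact_nseq_cat; last first.
    by apply/negP => /mapP[].
  rewrite multfact_map; last by move=> ? ? [].
  have -> : \prod_(p <- L) beta p.2.1 = \prod_(v <- children t) alpha_tree v.
    rewrite -[LHS](big_map (fun p : tree m * cut => p.2.1) predT beta) Lks.
    by rewrite big_cat big_map /= big_nseq iter_mulr_1 expr1n mul1r.
  have bL0 : \prod_(v <- children t) alpha_tree v != 0 :> R.
    by rewrite prodf_seq_neq0; apply/allP => v _ /=; rewrite alpha_tree_neq0.
  rewrite alpha_treeE -natr_prod -/(multfact _) natrM.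
  field; rewrite bL0 !pnatr_eq0 -!lt0n multfact_gt0 fact_gt0 //.
rewrite exchange_big sum_cuts_le //= big_seq [RHS]big_seq; apply: eq_bigr => u.
rewrite mem_trees => /eqP uM; rewrite -!scaler_suml sum_weight; congr (_ *: _).
rewrite (exchange_big_dep (fun D => trunk (root u) D == Some t)) /=; last first.
  by move=> i D _ /andP[].
rewrite big_seq_cond [RHS]big_seq_cond; apply: eq_bigr => D /andP[Du /eqP Dt].
(* Each decomposition occurs for one Taylor index only, and that index is in range. *)
have [sD1 sD2] := size_decomps_le Du Dt.
have ij : (size (D : decomposition) - size (children t) < j.+1)%N.
  by rewrite ltnS (leq_trans sD2) // uM /M addnK.
rewrite (big_pred1 (Ordinal ij)) // => i /=; rewrite Dt eqxx -val_eqE /=.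
by apply/eqP/eqP => [->|->]; rewrite ?addnK ?subnK.
Qed.

End ElementaryDifferentialsAtSeries.

(** * Dependence on finitely many coefficients *)

Section Locality.
Variables (R : realType) (m d : nat).
Local Notation V := 'rV[R]_d.

Lemma multilin_fs_local (Y : eqType) (ks : seq Y) (Vf Wf : Y -> nat -> V) M n :
  {in ks, forall k i, (i <= n)%N -> Vf k i = Wf k i} ->
  multilin_fs M (map Vf ks) n = multilin_fs M (map Wf ks) n.
Proof.
elim: ks n M => //= k ks IH n M VW; apply: eq_bigr => i _.
have ni : (i <= n)%N by rewrite -ltnS.
rewrite VW ?mem_head //; apply: IH => k' k's j jn; apply: VW.
  by rewrite inE k's orbT.
exact: leq_trans jn (leq_subr _ _).
Qed.

(** Order [n] of a product involves only orders up to [n] of its factors; by induction on [t] this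
    passes through Taylor's formula. *)
Lemma elem_diff_tree_fs_local (g : 'I_m.+1 -> V -> V) (Y1 Y2 : nat -> V) t n :
  (forall i, (i <= n)%N -> Y1 i = Y2 i) ->
  elem_diff_tree_fs g Y1 t n = elem_diff_tree_fs g Y2 t n.
Proof.
move=> Y12; have [N] := ubnP (order t); elim: N t n Y12 => // N IH t n Y12 tN.
rewrite !elem_diff_tree_fsE /taylor_fs; apply: eq_bigr => i _; rewrite Y12 //.
pose Vf Y (tau : T m) :=
  if tau is Some u then elem_diff_tree_fs g Y u else fun i => if i == 0%N then 0 else Y i.
have E Y : nseq i (fun i => if i == 0%N then 0 else Y i) ++
    [seq elem_diff_tree_fs g Y u | u <- children t] =
    map (Vf Y) (nseq i None ++ map Some (children t)).
  by rewrite map_cat map_nseq -map_comp.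
rewrite !E; congr (_ *: _); apply: multilin_fs_local => -[u|] ku j jn /=.
  have ut : u \in children t.
    by move: ku; rewrite mem_cat mem_nseq /= andbF mem_map // => ? ? [].
  apply: IH; first by move=> l lj; apply: Y12; apply: leq_trans lj jn.
  exact: leq_trans (order_child ut) tN.
by rewrite Y12.
Qed.

End Locality.

(** * The composition rule and the formal equation *)

Section Composition.
Context {disp : measure_display} {Omega : measurableType disp} {R : realType}.
Context {P : probability Omega R} {m d : nat}.
Local Notation V := 'rV[R]_d.
Implicit Types (phi : T m -> Xi P) (h : {nonneg R}) (w : Omega) (tau : T m).

Lemma compE (phix phiy : T m -> Xi P) tau h w :
  comp phix phiy tau h w =
  \sum_(p <- ST tau) (phiy p.1 h w *
    \prod_(delta <- (p.2 : {mset T m})) phix delta h w) *+ gamma tau p.1 p.2.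
Proof.
rewrite /comp mfun_sum; apply: eq_bigr => p _.
rewrite mfunMn mfunM /=; congr (_ * _ *+ _).
exact: (big_morph (fun f : {RV P >-> R} => f w)).
Qed.

Lemma comp_empty (phix phiy : T m -> Xi P) h :
  phiy None h = 0 -> comp phix phiy None h = 0.
Proof. by move=> y0; rewrite /comp big_seq_fset1 /= y0 mul0r mul0rn. Qed.

(* Only strictly smaller trees are left over by a nonempty subtree. *)
Lemma comp_local (phi1 phi2 phiy : T m -> Xi P) tau : (forall h, phiy None h = 0) ->
  (forall delta, (orderT delta < orderT tau)%N -> phi1 delta = phi2 delta) ->
  comp phi1 phiy tau = comp phi2 phiy tau.
Proof.
move=> y0; case: tau => [t|] e; apply/funext => h; last by rewrite !comp_empty.
rewrite /comp big_seq [RHS]big_seq; apply: eq_bigr => -[[u|] om] cu /=; last first.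
  by rewrite y0 !mul0r.
congr (_ * _ *+ _); rewrite big_seq [RHS]big_seq; apply: eq_bigr => delta dom.
by rewrite e //=; apply: ST_tree_remainder_lt cu _ dom.
Qed.

(** The recursion is iterated from 0; by [comp_local] the value at [tau] is final after
    [orderT tau + 1] rounds. *)
Lemma implicit_taylor_coef_exists (Phiex Phiim : T m -> Xi P) :
  (forall h, Phiex None h = 1) -> (forall h, Phiim None h = 0) ->
  exists Phi : T m -> Xi P, implicit_taylor_coef Phiex Phiim Phi.
Proof.
move=> ex0 im0.
pose next phi : T m -> Xi P := fun tau h => Phiex tau h + comp phi Phiim tau h.
pose it k := iter k next (fun _ _ => 0).
have itP : forall n k tau, (orderT tau <= n)%N -> (orderT tau <= k)%N ->
    it n.+1 tau = it k.+1 tau.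
  elim=> [|n IH] k tau tn tk; apply/funext => h; rewrite /= /next.
    congr (_ + _); rewrite (@comp_local (it 0%N) (it k)) // => delta.
    by move: tn; rewrite leqn0 => /eqP ->.
  congr (_ + _); rewrite (@comp_local (it n.+1) (it k)) // => delta dt.
  have := leq_trans dt tk; case: k {tk} => // k dk.
  by apply: IH => //; rewrite -ltnS (leq_trans dt).
(* Each tree is read off at a round where its value is final; at the empty tree the composition
   vanishes and [Phiex None h = 1] remains. *)
exists (fun tau => it (orderT tau).+1 tau); split=> [h|tau h].
  by rewrite /= /next comp_empty // addr0.
rewrite {1}/it /= /next; congr (_ + _); apply: (congr1 (@^~ h)).
apply: comp_local => // delta.
by case: (orderT tau) => // n dn; apply: itP.
Qed.

Variable g : 'I_m.+1 -> V -> V.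
Hypothesis g_smooth : forall l, smooth (g l).

Lemma Bterm0 phi h w (x : V) : Bterm g phi h w x 0 = phi None h w *: x.
Proof. by rewrite /Bterm sum_order0 /= mul1r. Qed.

Lemma Bterm_pos phi h w (x : V) n : (0 < n)%N -> Bterm g phi h w x n =
  \sum_(t <- trees m n) (alpha_tree t * phi (Some t) h w) *: elem_diff_tree g t x.
Proof. exact: sum_order. Qed.

Lemma Bhom_fs_trees phi h w Y k j : phi None h = 0 -> Bhom_fs g phi h w Y k j =
  \sum_(t <- trees m k) (alpha_tree t * phi (Some t) h w) *: elem_diff_tree_fs g Y t j.
Proof.
move=> p0; case: k => [|k]; last exact: sum_order.
rewrite /Bhom_fs sum_order0 /= p0 mulr0 scale0r.
rewrite big1_seq // => t /=; rewrite mem_trees => /eqP t0.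
by move: (order_gt0 t); rewrite t0.
Qed.

Lemma sum_trees_le (W : nmodType) (G : nat -> tree m -> W) n :
  \sum_(k < n.+1) \sum_(t <- trees m k) G k t =
  \sum_(t <- trees_le m n) G (order t) t.
Proof.
transitivity (\sum_(k < n.+1) \sum_(t <- trees_le m n | order t == k) G k t).
  apply: eq_bigr => k _; have kn : (k <= n)%N by rewrite -ltnS.
  by rewrite -(perm_big _ (filter_trees_le m kn)) big_filter.
rewrite (exchange_big_dep predT) //= big_seq [RHS]big_seq; apply: eq_bigr => t.
rewrite mem_trees_le -ltnS => tn; by rewrite (big_pred1 (Ordinal tn)).
Qed.

(** Each [F(t)(Z)] is expanded over the cuts with subtree [t]; after interchanging the sums over [t]
    and over the whole trees [u], the cuts of one [u] make up [comp Phi Phiim] at [u]. *)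
Lemma Bseries_fs_Bterm (Phi Phiim : T m -> Xi P) h w (x0 : V) n :
  Phi None h = 1 -> Phiim None h = 0 ->
  Bseries_fs g Phiim h w (Bterm g Phi h w x0) n = Bterm g (comp Phi Phiim) h w x0 n.
Proof.
move=> P1 im0; set Z := Bterm g Phi h w x0; pose a tau := Phi tau h w.
have a1 : a None = 1 by rewrite /a P1.
have Z0 : Z 0%N = x0 by rewrite /Z Bterm0 P1 scale1r.
have ZE k : (0 < k)%N -> Z k = \sum_(t <- trees m k)
    (alpha_tree t * a (Some t)) *: elem_diff_tree g t x0 by apply: Bterm_pos.
rewrite /Bseries_fs.
under eq_bigr => k _ do rewrite Bhom_fs_trees //.
rewrite (sum_trees_le (fun k t => (alpha_tree t * Phiim (Some t) h w) *:
  elem_diff_tree_fs g Z t (n - k))).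
transitivity (\sum_(t <- trees_le m n) \sum_(u <- trees m n)
  \sum_(c <- ST_tree u | c.1 == Some t)
    (Phiim (Some t) h w * weight a (u, c)) *: elem_diff_tree g u x0).
  rewrite big_seq [RHS]big_seq; apply: eq_bigr => t; rewrite mem_trees_le => tn.
  rewrite mulrC -scalerA (elem_diff_tree_fs_sum g_smooth a1 Z0 ZE (N := n)) ?subnK //.
  rewrite sum_cuts_le // scaler_sumr; apply: eq_bigr => u _.
  by rewrite scaler_sumr; apply: eq_bigr => c _; rewrite scalerA.
have [n0|n0] := posnP n.
  rewrite n0 Bterm0 comp_empty // scale0r big1_seq // => t /=.
  by rewrite mem_trees_le leqn0 => /eqP t0; move: (order_gt0 t); rewrite t0.
rewrite Bterm_pos // exchange_big /= big_seq [RHS]big_seq; apply: eq_bigr => u.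
rewrite mem_trees => /eqP un; rewrite compE mulr_sumr scaler_suml.
rewrite (exchange_big_dep predT) //= big_seq [RHS]big_seq; apply: eq_bigr => c cu.
have cn := ST_tree_order cu; rewrite un in cn.
(* Cuts with empty subtree drop out by [im0]; any other is met at exactly one [t]. *)
case: c cu cn => -[t|] om cu cn /=; last by rewrite big1 ?im0 ?mul0r ?mul0rn ?mulr0 ?scale0r.
rewrite (@sum_only1 _ _ _ _ _ t) ?trees_le_uniq ?mem_trees_le ?eqxx //; last first.
  by move=> t' _ /eqP[].
by congr (_ *: _); rewrite /weight /= -mulr_natr /a; ring.
Qed.

Section ImplicitStep.
Variables (Phiex Phiim Phi : T m -> Xi P) (h : {nonneg R}) (w : Omega) (x0 : V).
Hypothesis im0 : Phiim None h = 0.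

Lemma formal_step_Bterm : implicit_taylor_coef Phiex Phiim Phi ->
  formal_step g Phiex Phiim h w x0 (Bterm g Phi h w x0).
Proof.
move=> [P1 PE] n; rewrite Bseries_fs_Bterm //.
have [->|n0] := posnP n; first by rewrite !Bterm0 PE mfunD scalerDl.
rewrite !Bterm_pos // -big_split; apply: eq_bigr => t _.
by rewrite PE mfunD mulrDr scalerDl.
Qed.

Lemma formal_step_unique (Y1 Y2 : nat -> V) :
  formal_step g Phiex Phiim h w x0 Y1 -> formal_step g Phiex Phiim h w x0 Y2 ->
  Y1 =1 Y2.
Proof.
move=> s1 s2 n; have [N] := ubnP n; elim: N n => // N IH n nN.
rewrite s1 s2; congr (_ + _); apply: eq_bigr => k _; rewrite !Bhom_fs_trees //.
rewrite big_seq [RHS]big_seq; apply: eq_bigr => t; rewrite mem_trees => /eqP tk.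
congr (_ *: _); apply: elem_diff_tree_fs_local => i ik; apply: IH.
(* As [t] has a vertex, [k >= 1], so that [i <= n - k < n]. *)
by move: (order_gt0 t) (ltn_ord k) nN ik; rewrite tk; lia.
Qed.

End ImplicitStep.
End Composition.

(** * Rearrangement of absolutely convergent double series *)

Lemma cvg_sum_seq (R : numFieldType) (W : normedModType R) (I : Type) (r : seq I)
    (u : I -> nat -> W) (l : I -> W) : (forall i, u i @ \oo --> l i) ->
  (fun n => \sum_(i <- r) u i n) @ \oo --> \sum_(i <- r) l i.
Proof.
move=> ul; elim: r => [|i r IH].
  by under eq_fun do rewrite big_nil; rewrite big_nil; apply: cvg_cst.
by under eq_fun do rewrite big_cons; rewrite big_cons; apply: cvgD.
Qed.

Lemma normed_cvg_rV (R : realType) (d : nat) (u : nat -> 'rV[R]_d) :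
  cvgn [normed series u] -> cvgn (series u).
Proof.
move=> /cauchy_cvgP/cauchy_seriesP u_cvg.
apply: cauchy_cvg; apply/cauchy_seriesP => e /u_cvg.
apply: filterS => n /=; rewrite ger0_norm ?sumr_ge0 //.
by apply: le_lt_trans; apply: ler_norm_sum.
Qed.

Section DoubleSeries.
Variable R : realType.

(** Rectangles, and triangles in [sum_diag_widen], become masked sums over one large square and can
    then be compared term by term. *)
Lemma sum_rect_widen (W : nmodType) (F : nat -> nat -> W) K J M :
  (K <= M)%N -> (J <= M)%N ->
  \sum_(k < K) \sum_(j < J) F k j =
  \sum_(k < M) \sum_(j < M) (if (k < K)%N && (j < J)%N then F k j else 0).
Proof.
move=> KM JM; rewrite (big_ord_widen M (fun k => \sum_(j < J) F k j) KM) big_mkcond.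
apply: eq_bigr => k _; case: ifP => kK; last by rewrite big1.
by rewrite (big_ord_widen M (F k) JM) big_mkcond.
Qed.

Lemma sum_diag_widen (W : nmodType) (F : nat -> nat -> W) L M : (L <= M)%N ->
  \sum_(n < L) \sum_(k < n.+1) F k (n - k)%N =
  \sum_(k < M) \sum_(j < M) (if (k + j < L)%N then F k j else 0).
Proof.
elim: L => [|L IH] LM.
  by rewrite big_ord0 big1 // => k _; rewrite big1.
rewrite big_ord_recr /= IH 1?ltnW //.
rewrite (big_ord_widen M (fun k => F k (L - k)%N) LM) [in X in _ + X]big_mkcond -big_split.
apply: eq_bigr => k _ /=; case: ifP => kL; last first.
  rewrite addr0; apply: eq_bigr => j _.
  by rewrite !ifF //; apply/negbTE; lia.
have LkM : (L - k < M)%N by lia.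
have -> : F k (L - k)%N = \sum_(j < M) (if j == Ordinal LkM then F k j else 0).
  by rewrite -big_mkcond big_pred1_eq.
rewrite -big_split; apply: eq_bigr => j _ /=.
have [->|jL] := eqVneq j (Ordinal LkM); first by rewrite /= ifF ?ifT ?add0r //; lia.
rewrite addr0; congr (if _ then _ else _).
by move: jL; rewrite -val_eqE /=; lia.
Qed.

Variable d : nat.
Local Notation V := 'rV[R]_d.
Variables (b : nat -> nat -> V) (C : R).
Hypothesis bC : forall K J, \sum_(k < K) \sum_(j < J) `|b k j| <= C.

Let A N := \sum_(k < N) \sum_(j < N) `|b k j|.
Let Q N := \sum_(k < N) \sum_(j < N) b k j.

(** The terms in the square of side [N] cancel; the others lie between the two squares, where the
    norms sum to [A M - A N]. *)
Lemma sum_near_square (p : nat -> nat -> bool) N M : (N <= M)%N ->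
  (forall k j, (k < N)%N -> (j < N)%N -> p k j) ->
  `|\sum_(k < M) \sum_(j < M) (if p k j then b k j else 0) - Q N| <= A M - A N.
Proof.
move=> NM pP; rewrite /A /Q (sum_rect_widen b NM NM) (sum_rect_widen (fun k j => `|b k j|) NM NM).
rewrite -!sumrB.
rewrite (le_trans (ler_norm_sum _ _ _)) // ler_sum // => k _; rewrite -!sumrB.
rewrite (le_trans (ler_norm_sum _ _ _)) // ler_sum // => j _.
case: ifPn => pkj; last first.
  rewrite ifF ?subr0 ?normr0 //; last by apply: contraNF pkj => /andP[? ?]; apply: pP.
  by rewrite ifF ?subr0 //; apply: contraNF pkj => /andP[? ?]; apply: pP.
by case: ifP => _; rewrite ?subrr ?normr0 // !subr0.
Qed.

(** [A] is nondecreasing and bounded by [C], hence converges to its supremum, which bounds every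
    [A M]. *)
Lemma square_tail (e : R) : 0 < e ->
  exists N, forall M, (N <= M)%N -> A M - A N <= e.
Proof.
move=> e0; have And : {homo A : n m / (n <= m)%N >-> n <= m}.
  move=> n M nM; rewrite /A (sum_rect_widen (fun k j => `|b k j|) nM nM) ler_sum // => k _.
  by rewrite ler_sum // => j _; case: ifP.
have Aub : has_ubound (range A) by exists C => _ [N _ <-]; apply: bC.
have Acvg := nondecreasing_cvgn And Aub.
have [N _ NP] := (cvgrPdist_le _ _).1 Acvg e e0.
exists N => M NM; have := NP N (leqnn N); apply: le_trans.
rewrite (le_trans _ (ler_norm _)) // lerD2r.
by apply: ub_le_sup => //; exists M.
Qed.

(** The diagonal series converges absolutely, with bound [C]. Its limit and the late partial sums of
    the row sums both lie within [e / 2] of one square sum [Q N]. *)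
Lemma double_series (r : nat -> V) :
  (forall k, series (b k) @ \oo --> r k) ->
  exists s : V, series r @ \oo --> s /\
    series (fun n => \sum_(k < n.+1) b k (n - k)%N) @ \oo --> s.
Proof.
move=> br; pose D n := \sum_(k < n.+1) b k (n - k)%N.
have DE L M : (L <= M)%N -> series D L =
    \sum_(k < M) \sum_(j < M) (if (k + j < L)%N then b k j else 0).
  by move=> LM; rewrite seriesEord /= (sum_diag_widen b LM).
have [s Ds] : exists s : V, series D @ \oo --> s.
  apply/cvg_ex; apply: normed_cvg_rV; apply: nondecreasing_is_cvgn.
    exact: (@nondecreasing_series _ (fun n => `|D n|) predT 0).
  exists C => _ [L _ <-]; rewrite /= seriesEord; apply: le_trans (bC L L).
  apply: (@le_trans _ _ (\sum_(n < L) \sum_(k < n.+1) `|b k (n - k)%N|)).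
    by apply: ler_sum => n _; apply: ler_norm_sum.
  rewrite (sum_diag_widen (fun k j => `|b k j|) (leqnn L)).
  by apply: ler_sum => k _; apply: ler_sum => j _; case: ifP.
exists s; split=> //.
have closed_norm (u : nat -> V) (l q : V) (e : R) N0 : u @ \oo --> l ->
    (forall n, (N0 <= n)%N -> `|u n - q| <= e) -> `|l - q| <= e.
  move=> ul uq; have ulq : `|u n - q| @[n --> \oo] --> `|l - q|.
    by apply: cvg_norm; apply: cvgB => //; apply: cvg_cst.
  by apply: cvgr_to_le ulq _; exists N0.
apply/cvgrPdist_le => e e0; have e2 : 0 < e / 2 by rewrite divr_gt0.
have [N NP] := square_tail e2; exists N => // K NK.
have NK' : (N <= K)%N by [].
have sQ : `|s - Q N| <= e / 2.
  (* From [L = N + N] on, the triangle [k + j < L] contains the square of side [N]. *)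
  apply: (closed_norm _ _ _ _ (N + N)%N Ds) => L NL.
  rewrite (DE _ _ (leqnn L)).
  have NL' : (N <= L)%N by lia.
  rewrite (le_trans (sum_near_square (p := fun k j => (k + j < L)%N) NL' _)) ?NP //.
  by move=> k j kN jN; lia.
have rQ : `|series r K - Q N| <= e / 2.
  (* A partial sum of the row sums is a limit of sums over rectangles, which contain that square
     once [J >= N]. *)
  have rK : (fun J => \sum_(k < K) series (b k) J) @ \oo --> series r K.
    rewrite seriesEord /=; exact: cvg_sum_seq.
  apply: (closed_norm _ _ _ _ N rK) => J NJ.
  have NM : (N <= maxn K J)%N by rewrite leq_max NK'.
  have -> : \sum_(k < K) series (b k) J = \sum_(k < K) \sum_(j < J) b k j.
    by apply: eq_bigr => k _; rewrite seriesEord.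
  rewrite (sum_rect_widen b (leq_maxl K J) (leq_maxr K J)).
  rewrite (le_trans (sum_near_square (p := fun k j => (k < K)%N && (j < J)%N) NM _)) ?NP //.
  by move=> k j kN jN; rewrite (leq_trans kN NK') (leq_trans jN NJ).
rewrite -(subrKA (Q N)) (splitr e) (le_trans (ler_normD _ _)) // lerD //.
by rewrite distrC.
Qed.

End DoubleSeries.

(** * From the formal to the convergent equation *)

Section ConvergentStep.
Context {disp : measure_display} {Omega : measurableType disp} {R : realType}.
Context {P : probability Omega R} {m d : nat}.
Local Notation V := 'rV[R]_d.
Variables (g : 'I_m.+1 -> V -> V) (Phiex Phiim : T m -> Xi P).
Variables (h : {nonneg R}) (w : Omega) (Y : nat -> V) (y : V).
Hypothesis im0 : Phiim None h = 0.
Hypothesis Yy : expansions_converge g Phiim h w Y y.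

(** Row [k] is a finite combination of the expansions of [F(t)(Y)], each converging to [F(t)(y)];
    row 0 vanishes by [im0]. *)
Lemma series_Bhom_fs k :
  series (Bhom_fs g Phiim h w Y k) @ \oo --> Bterm g Phiim h w y k.
Proof.
have [_ Ycvg _] := Yy.
have -> : Bterm g Phiim h w y k =
    \sum_(t <- trees m k) (alpha_tree t * Phiim (Some t) h w) *: elem_diff_tree g t y.
  case: k => [|k]; last exact: sum_order.
  rewrite Bterm0 im0 scale0r big1_seq // => t /=; rewrite mem_trees => /eqP t0.
  by move: (order_gt0 t); rewrite t0.
have -> : series (Bhom_fs g Phiim h w Y k) = fun J => \sum_(t <- trees m k)
    (alpha_tree t * Phiim (Some t) h w) *: series (elem_diff_fs g Y (Some t)) J.
  apply/funext => J; rewrite seriesEord /=.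
  under eq_bigr => j _ do rewrite Bhom_fs_trees //.
  by rewrite exchange_big; apply: eq_bigr => t _; rewrite seriesEord scaler_sumr.
by apply: cvg_sum_seq => t; apply: cvgZ (cvg_cst _) (Ycvg (Some t)).
Qed.

Lemma step_of_formal_step x0 :
  formal_step g Phiex Phiim h w x0 Y -> step g Phiex Phiim h w x0 y.
Proof.
move=> Ystep; have [Ycvg _ [C bC]] := Yy.
have [s [Bs Ds]] := double_series bC series_Bhom_fs.
(* The rows sum to [B(Phiim, y; h)], the diagonals are the coefficients of [Bseries_fs], and both
   have the sum [s]; subtracting them from [Y] leaves the explicit series with sum [y - s]. *)
exists (y - s), s; split=> //; last by rewrite subrK.
have -> : series (Bterm g Phiex h w x0) =
    series Y - series (Bseries_fs g Phiim h w Y).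
  apply/funext => n; rewrite !seriesEord /= -[RHS]sumrB.
  by apply: eq_bigr => i _; rewrite Ystep addrK.
exact: cvgB.
Qed.

End ConvergentStep.

Theorem theorem4 (disp : measure_display) (Omega : measurableType disp)
    (R : realType) (P : probability Omega R) (m d : nat)
    (g : 'I_m.+1 -> 'rV[R]_d -> 'rV[R]_d) (x0 : 'rV[R]_d)
    (Phiex Phiim : T m -> Xi P) :
  (forall l, smooth (g l)) ->
  (forall h, Phiex None h = 1) ->
  (forall h, Phiim None h = 0) ->
  (exists Phi : T m -> Xi P, implicit_taylor_coef Phiex Phiim Phi) /\
  forall Phi : T m -> Xi P, implicit_taylor_coef Phiex Phiim Phi ->
  forall (h : {nonneg R}) (w : Omega),
    (forall Y1 : nat -> 'rV[R]_d,
       formal_step g Phiex Phiim h w x0 Y1 <->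
       forall n, Y1 n = Bterm g Phi h w x0 n) /\
    (forall (Y : nat -> 'rV[R]_d) (Y1 : 'rV[R]_d),
       formal_step g Phiex Phiim h w x0 Y ->
       expansions_converge g Phiim h w Y Y1 ->
       step g Phiex Phiim h w x0 Y1 /\
       series (Bterm g Phi h w x0) @ \oo --> Y1).
Proof.
move=> g_smooth ex0 im0; split; first exact: implicit_taylor_coef_exists.
move=> Phi PhiP h w; have Bstep := formal_step_Bterm g_smooth w x0 (im0 h) PhiP.
(* By uniqueness every formal solution is the B-series of [Phi], so the convergence assumed for [Y]
   carries over to that B-series. *)
have Yuniq Y : formal_step g Phiex Phiim h w x0 Y -> Y =1 Bterm g Phi h w x0.
  by move=> Ystep; exact: (formal_step_unique (im0 h) Ystep Bstep).
split=> [Y|Y y Ystep Yy]; first split=> [/Yuniq //|YE].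
  by have -> : Y = Bterm g Phi h w x0 by apply/funext.
split; first exact: step_of_formal_step Ystep.
have [Ycvg _ _] := Yy.
by have <- : Y = Bterm g Phi h w x0 by apply/funext/Yuniq.
Qed.
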